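(* Let $\mathcal{E}$ be a countable directed graph without sinks and $S$ its graph inverse semigroup. The universal groupoid $H$ of $S$ can be identified with the union of $\{z\}$ and the set of all triples of the form $(\alpha\gamma,\,l(\alpha)-l(\beta),\,\beta\gamma)$ where $\alpha,\beta\in Y$, $\gamma\in Y\cup Z$, and $\alpha\gamma,\beta\gamma\in Y\cup Z$. Multiplication on $H$ is given by $(x,m,y)(y,n,w)=(x,m+n,w)$ and inversion by $(x,m,y)^{-1}=(y,-m,x)$. The canonical map $\Psi:S\to H^{a}$ sends $z$ to $\{z\}$ and any element $(\alpha,\beta)$ to the (compact open) set $A_{\alpha,\beta}$ of all triples of the form $(\alpha\gamma,l(\alpha)-l(\beta),\beta\gamma)$. The locally compact groupoid $H$ is Hausdorff.
   Context: Graph conventions. $\mathcal{E}$ is a directed graph with countable vertex set $V$ and countable edge set $E$; $s(e),r(e)$ are the initial and terminal vertices of an edge $e$. No sinks: every vertex is the source of at least one edge. A finite path is $\alpha=e_1\cdots e_k$ with $r(e_i)=s(e_{i+1})$, length $l(\alpha)=k$, $s(\alpha)=s(e_1)$, $r(\alpha)=r(e_k)$; each vertex $v$ is a finite path of length $0$ with $s(v)=r(v)=v$, and $s(\mu)\mu=\mu=\mu r(\mu)$. $Y$ is the set of finite paths, $Z$ the set of infinite paths. A concatenation $\alpha\gamma$ is defined only when $r(\alpha)=s(\gamma)$. Graph inverse semigroup. $S$ consists of the pairs $(\alpha,\beta)$ of finite paths with $r(\alpha)=r(\beta)$ together with a zero element $z$, with involution $(\alpha,\beta)^*=(\beta,\alpha)$,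 $z^*=z$, and product $(\alpha,\alpha'\mu)(\alpha',\beta)=(\alpha,\beta\mu)$, $(\alpha,\alpha')(\alpha'\mu,\beta')=(\alpha\mu,\beta')$, all other products being $z$. Its semilattice of idempotents $I=\{(\alpha,\alpha):\alpha\in Y\}\cup\{z\}$ is identified with $Y\cup\{z\}$. Universal groupoid of a countable inverse semigroup $S$ with idempotent semilattice $I$. The unit space $H^0$ is the set of non-zero semicharacters (multiplicative maps) $\chi:I\to\{0,1\}$ with the topology of pointwise convergence. For $s\in S$ let $D_s=\{x\in H^0: x(ss^* )=1\}$, and for $x\in D_s$ define $x.s\in H^0$ by $(x.s)(\alpha)=x(s\alpha s^* )$. $H$ is the quotient of $\{(x,s):s\in S,\ x\in D_s\}$ by the relation $(x,s)\sim(y,t)$ iff $x=y$ and there is $\alpha\in I$ with $x(\alpha)=1$ and $\alpha s=\alpha t$. Product: $\overline{(x,s)}\,\overline{(x.s,t)}=\overline{(x,st)}$; inverse: $\overline{(x,s)}^{-1}=\overline{(x.s,s^* )}$. The canonical map is $\Psi(s)=\{\overline{(x,s)}:x\in D_s\}$, and a basis for the topology of $H$ is given by the sets $(D_\alpha\cap D_{\alpha_1}^c\cap\cdots\cap D_{\alpha_n}^c)\Psi(s)$ with $s\in S$, $\alpha,\alpha_i\in I$, $\alpha_i\le\alpha$. $H^a$ denotes the ample semigroup of $H$: the inverse semigroup of compact, open, Hausdorff subsets of $H$. Identification of $H^0$ for the graph inverse semigroup: $\gamma\in Y\cup Z$ is identified with the semicharacter taking the value $1$ exactly on those $\alpha\in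 Y$ that are initial segments of $\gamma$ (and $0$ at $z\in I$), and $z\in H^0$ denotes the constant semicharacter $1$; then $H^0=Y\cup Z\cup\{z\}$.
   Formalization: The canonical map is shown to send (α,β) to A_{α,β} ∪ {z} rather than A_{α,β}: the constant semicharacter z lies in D_s for every s, and its class under (α,β) is the unit z, so z always belongs to Ψ(α,β). A_{α,β} itself is still proved compact and open. *)

(* Defs.v *)
From HB Require Import structures.
From mathcomp Require Import all_boot all_order all_algebra.
From mathcomp Require Import all_classical topology.

Set Implicit Arguments.
Unset Strict Implicit.
Unset Printing Implicit Defensive.

Local Open Scope classical_set_scope.
Local Open Scope group_scope.

HB.mixin Record Semigroup_isInverse S of Semigroup S := {
  star : S -> S;
  mulgsK : forall s : S, s * star s * s = s;
  mulsgK : forall s : S, star s * s * star s = star s;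
  star_unique : forall s t : S, s * t * s = s -> t * s * t = t -> t = star s
}.

#[short(type="invSemigroupType")]
HB.structure Definition InvSemigroup := {S of Semigroup S & Semigroup_isInverse S}.

Section InvSemigroupTheory.
Variable S : invSemigroupType.
Implicit Types s t e f : S.

Lemma starK s : star (star s) = s.
Proof. by apply/esym/star_unique; rewrite ?mulgsK ?mulsgK. Qed.

Lemma star_idem e : e * e = e -> star e = e.
Proof. by move=> ee; apply/esym/star_unique; rewrite !ee. Qed.

Lemma idemM e f : e * e = e -> f * f = f -> e * f * (e * f) = e * f.
Proof.
move=> ee ff; set x := star (e * f).
have xK : x * (e * f) * x = x by rewrite mulsgK.
have eK : e * f * x * (e * f) = e * f by rewrite mulgsK.
have x1 : f * x * e = x.
  apply: star_unique.
    transitivity (e * (f * f) * x * (e * e) * f); first by rewrite !mulgA.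
    by rewrite ee ff -[RHS]eK !mulgA.
  transitivity (f * x * (e * e) * (f * f) * x * e); first by rewrite !mulgA.
  by rewrite ee ff -[in RHS]xK !mulgA.
have xx : x * x = x.
  transitivity (f * (x * (e * f) * x) * e); last by rewrite xK.
  by rewrite -[in LHS]x1 !mulgA.
by rewrite -[e * f]starK -/x (star_idem xx).
Qed.

Lemma idemC e f : e * e = e -> f * f = f -> e * f = f * e.
Proof.
move=> ee ff; have ef := idemM ee ff; have fe := idemM ff ee.
rewrite -(star_idem ef); apply/esym/star_unique.
  by rewrite !mulgA -(mulgA e f f) ff -(mulgA _ e e) ee -mulgA.
by rewrite !mulgA -(mulgA f e e) ee -(mulgA _ f f) ff -mulgA.
Qed.

Lemma idem_ran s : (s * star s) * (s * star s) = s * star s.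
Proof. by rewrite mulgA mulgsK. Qed.

Lemma idem_dom s : (star s * s) * (star s * s) = star s * s.
Proof. by rewrite mulgA mulsgK. Qed.

Lemma starM s t : star (s * t) = star t * star s.
Proof.
have C := idemC (idem_ran t) (idem_dom s).
apply/esym/star_unique.
  transitivity (s * (t * star t * (star s * s)) * t); first by rewrite !mulgA.
  rewrite C; transitivity ((s * star s * s) * (t * star t * t)).
    by rewrite !mulgA.
  by rewrite !mulgsK.
transitivity (star t * ((star s * s) * (t * star t)) * star s).
  by rewrite !mulgA.
rewrite -C; transitivity ((star t * t * star t) * (star s * s * star s)).
  by rewrite !mulgA.
by rewrite !mulsgK.
Qed.

Lemma idem_conj s e : e * e = e -> (s * e * star s) * (s * e * star s) = s * e * star s.
Proof.
move=> ee; transitivity (s * (e * (star s * s)) * e * star s).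
  by rewrite !mulgA.
rewrite (idemC ee (idem_dom s)); transitivity ((s * star s * s) * (e * e) * star s).
  by rewrite !mulgA.
by rewrite ee mulgsK.
Qed.

Lemma conjM s e f : e * e = e -> f * f = f ->
  s * (e * f) * star s = (s * e * star s) * (s * f * star s).
Proof.
move=> ee ff; transitivity (s * star s * s * e * f * star s).
  by rewrite mulgsK !mulgA.
transitivity (s * ((star s * s) * e) * f * star s); first by rewrite !mulgA.
by rewrite -(idemC ee (idem_dom s)) !mulgA.
Qed.

End InvSemigroupTheory.

Section UniversalGroupoid.
Variable S : invSemigroupType.
Implicit Types s t : S.

Definition idem : Type := {e : S | e * e == e}.
HB.instance Definition _ := Choice.on idem.

Lemma idemP (e : idem) : val e * val e = val e.
Proof. exact/eqP/(valP e). Qed.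

Definition idem_mul (e f : idem) : idem :=
  exist _ (val e * val f) (introT eqP (idemM (idemP e) (idemP f))).

Definition idem_le (e f : idem) : bool := val e * val f == val e.

Definition ran s : idem := exist _ (s * star s) (introT eqP (idem_ran s)).

Definition conj s (e : idem) : idem :=
  exist _ (s * val e * star s) (introT eqP (idem_conj s (idemP e))).

Record semichar := Semichar {
  semichar_fun :> idem -> bool;
  semicharM : forall e f, semichar_fun (idem_mul e f) = semichar_fun e && semichar_fun f;
  semichar_neq0 : exists e, semichar_fun e
}.

HB.instance Definition _ := gen_eqMixin semichar.
HB.instance Definition _ := gen_choiceMixin semichar.

Lemma semichar_ext (x y : semichar) : x =1 y -> x = y.
Proof.
case: x y => [x xM x0] [y yM y0] /= /funext exy; rewrite exy in xM x0 *.
by congr Semichar; exact: Prop_irrelevance.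
Qed.

(* D_s, so that D_e = {x | x e = 1} for e idempotent. *)
Definition in_dom (x : semichar) s : bool := x (ran s).

Lemma act_subproofM (x : semichar) s e f :
  x (conj s (idem_mul e f)) = x (conj s e) && x (conj s f).
Proof.
rewrite -semicharM; congr (x _); apply: val_inj => /=.
by rewrite conjM // idemP.
Qed.

Lemma act_subproof0 (x : semichar) s (xs : in_dom x s) : exists e, x (conj s e).
Proof.
exists (ran (star s)); suff <- : ran s = conj s (ran (star s)) by [].
by apply: val_inj => /=; rewrite starK !mulgA mulgsK.
Qed.

Definition act (x : semichar) s (xs : in_dom x s) : semichar :=
  Semichar (@act_subproofM x s) (act_subproof0 xs).

Definition pregerm : Type := {p : semichar * S | in_dom p.1 p.2}.
HB.instance Definition _ := Choice.on pregerm.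

Definition germ_equiv (p q : pregerm) : bool :=
  `[< (val p).1 = (val q).1 /\
      exists2 e : idem, (val p).1 e & val e * (val p).2 = val e * (val q).2 >].

Lemma germ_equiv_refl : reflexive germ_equiv.
Proof. by move=> p; apply/asboolP; split=> //; exists (ran (val p).2) => //; exact: (valP p). Qed.

Lemma germ_equiv_sym : symmetric germ_equiv.
Proof.
suff h p q : germ_equiv p q -> germ_equiv q p by move=> p q; apply/idP/idP; exact: h.
move=> /asboolP[pq [e pe epq]]; apply/asboolP; split=> //.
by exists e => //; rewrite -pq.
Qed.

Lemma germ_equiv_trans : transitive germ_equiv.
Proof.
move=> q p r /asboolP[pq [e pe epq]] /asboolP[qr [f qf fqr]].
apply/asboolP; split; first by rewrite pq.
exists (idem_mul e f); first by rewrite semicharM pe pq.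
by rewrite /= {1}(idemC (idemP e) (idemP f)) -mulgA epq mulgA
  -(idemC (idemP e) (idemP f)) -mulgA fqr mulgA.
Qed.

Canonical germ_equivrel :=
  EquivRel germ_equiv germ_equiv_refl germ_equiv_sym germ_equiv_trans.

Definition univ_groupoid : Type := {eq_quot germ_equiv}%qT.
Local Notation H := univ_groupoid.

HB.instance Definition _ := Choice.on H.
HB.instance Definition _ := Quotient.on H.
HB.instance Definition _ := EqQuotient.on H.

(* The class of (x, s). *)
Definition germ (x : semichar) s (xs : in_dom x s) : H :=
  (\pi_H (exist _ (x, s) xs : pregerm))%qT.

Lemma germP x s (xs : in_dom x s) y t (yt : in_dom y t) :
  germ xs = germ yt <-> x = y /\ exists2 e : idem, x e & val e * s = val e * t.
Proof.
rewrite /germ; split; first by move=> /eqquotP /asboolP.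
by move=> h; apply/eqquotP/asboolP.
Qed.

Lemma germ_surj (g : H) : exists x s (xs : in_dom x s), g = germ xs.
Proof.
elim/quotW: g => -[[x s] xs]; exists x, s, xs; rewrite /germ.
by congr (\pi _)%qT; apply: val_inj.
Qed.

Lemma in_dom_eq (x : semichar) s t (e : idem) :
  x e -> val e * s = val e * t -> in_dom x s -> in_dom x t.
Proof.
move=> xe est; rewrite /in_dom => xs.
have : x (ran (val e * s)).
  rewrite (_ : ran _ = idem_mul e (idem_mul (ran s) e)) ?semicharM ?xe ?xs //.
  by apply: val_inj => /=; rewrite starM (star_idem (idemP e)) !mulgA.
rewrite est (_ : ran _ = idem_mul e (idem_mul (ran t) e)) ?semicharM ?xe //= ?andbT //.
by apply: val_inj => /=; rewrite starM (star_idem (idemP e)) !mulgA.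
Qed.

Lemma act_eq (x : semichar) s t (e : idem) (xs : in_dom x s) (xt : in_dom x t) :
  x e -> val e * s = val e * t -> act xs = act xt.
Proof.
move=> xe est; apply: semichar_ext => f /=.
have E u : x (conj u f) = x (conj (val e * u) f).
  rewrite (_ : conj (val e * u) f = idem_mul e (idem_mul (conj u f) e)).
    by rewrite !semicharM xe andbT.
  by apply: val_inj => /=; rewrite starM (star_idem (idemP e)) !mulgA.
by rewrite E est -E.
Qed.

Definition grange (g : H) : semichar := (val (repr g : pregerm)).1.

Definition gsource (g : H) : semichar := act (valP (repr g : pregerm)).

Definition composable (g h : H) : Prop := gsource g = grange h.

(* The default of insubd is reached only on non-composable pairs. *)
Definition gmul (g h : H) : H :=
  (\pi_H (insubd (repr g : pregerm)
    ((val (repr g : pregerm)).1, (val (repr g : pregerm)).2 * (val (repr h : pregerm)).2)))%qT.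

Lemma inv_dom (x : semichar) s (xs : in_dom x s) : in_dom (act xs) (star s).
Proof.
rewrite /in_dom /= (_ : conj _ _ = ran s) //.
by apply: val_inj => /=; rewrite starK !mulgA mulgsK.
Qed.

Definition ginv (g : H) : H := germ (inv_dom (valP (repr g : pregerm))).

Lemma repr_germ x s (xs : in_dom x s) :
  exists t (xt : in_dom x t), (repr (germ xs) : pregerm) = exist _ (x, t) xt /\
    exists2 e : idem, x e & val e * s = val e * t.
Proof.
have : germ xs = germ xs by [].
rewrite -{1}[germ xs]reprK; case: (repr (germ xs)) => -[y t] /= yt.
move=> /(@germP _ _ yt)[yx [e ye est]]; subst y.
by exists t, yt; split=> //; exists e.
Qed.

Lemma grange_germ x s (xs : in_dom x s) : grange (germ xs) = x.
Proof. by rewrite /grange; have [t [xt [-> _]]] := repr_germ xs. Qed.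

Lemma gsource_germ x s (xs : in_dom x s) : gsource (germ xs) = act xs.
Proof.
rewrite /gsource; have [t [xt [-> [e xe est]]]] := repr_germ xs.
exact/esym/act_eq/est.
Qed.

Lemma mul_dom (x : semichar) s t (xs : in_dom x s) :
  in_dom (act xs) t -> in_dom x (s * t).
Proof.
rewrite /in_dom /= => h; rewrite (_ : ran _ = conj s (ran t)) //.
by apply: val_inj => /=; rewrite starM !mulgA.
Qed.

Lemma gmul_germ x s t (xs : in_dom x s) (yt : in_dom (act xs) t)
    (xst : in_dom x (s * t)) : gmul (germ xs) (germ yt) = germ xst.
Proof.
rewrite /gmul; have [s' [xs' [-> [e xe ess]]]] := repr_germ xs.
have [t' [yt' [-> [f yf fft]]]] := repr_germ yt => /=.
have xst' : in_dom x (s' * t').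
  apply: (@mul_dom _ _ _ xs'); rewrite -(act_eq xs xs' xe ess); exact: yt'.
rewrite /insubd insubT; apply/germP; split=> //.
exists (idem_mul e (conj s f)); first by rewrite semicharM xe.
have key u v : val e * s = val e * u ->
    val (idem_mul e (conj s f)) * (u * v) = val e * s * (val f * v).
  move=> esu; rewrite /= (idemC (idemP e) (idem_conj s (idemP f))).
  transitivity (s * val f * star s * (val e * u) * v); first by rewrite !mulgA.
  rewrite -esu; transitivity (s * val f * star s * val e * s * v).
    by rewrite !mulgA.
  rewrite -(mulgA _ _ (val e)).
  transitivity (((s * val f * star s) * val e) * s * v); first by rewrite !mulgA.
  rewrite -(idemC (idemP e) (idem_conj s (idemP f))).
  transitivity (val e * s * (val f * (star s * s)) * v); first by rewrite !mulgA.
  rewrite (idemC (idemP f) (idem_dom s)).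
  transitivity (val e * (s * star s * s) * (val f * v)); first by rewrite !mulgA.
  by rewrite mulgsK.
by rewrite (key _ _ ess) (key _ _ (erefl _)) fft.
Qed.

Lemma ginv_germ x s (xs : in_dom x s) : ginv (germ xs) = germ (inv_dom xs).
Proof.
rewrite /ginv; have [t [xt [-> [e xe est]]]] := repr_germ xs.
apply/germP => /=; split; first exact/esym/act_eq/est.
have K u : star u * val e * u * star u = star u * val e.
  rewrite -mulgA -(mulgA (star u)) (idemC (idemP e) (idem_ran u)) !mulgA.
  by rewrite mulsgK.
have E u v : val e * u = val e * v -> star u * val e = star v * val e.
  by move=> /(congr1 (@star S)); rewrite !starM (star_idem (idemP e)).
exists (conj (star t) e).
  rewrite /= (_ : conj t _ = idem_mul (ran t) (idem_mul e (ran t))) ?semicharM ?xe ?andbT.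
    by rewrite andbb; exact: xt.
  by apply: val_inj; rewrite /= starK !mulgA.
rewrite /= starK K.
have es := E _ _ est.
transitivity (star t * (val e * t) * star s); last by rewrite !mulgA.
by rewrite -est !mulgA -es K.
Qed.

(* (D_a /\ D_{b_1}^c /\ ... /\ D_{b_n}^c) Psi(s), for bs = b_1, ..., b_n. *)
Definition basic (a : idem) (bs : seq idem) s : set H :=
  [set g | exists x (xs : in_dom x s),
    [/\ x a, {in bs, forall b, ~~ x b} & g = germ xs]].

Definition basis : set (set H) :=
  [set A | exists a bs s, {in bs, forall b, idem_le b a} /\ A = basic a bs s].

Lemma basis_cover : \bigcup_(A in basis) A = setT.
Proof.
apply/seteqP; split=> // g _; have [x [s [xs ->]]] := germ_surj g.
exists (basic (ran s) [::] s); first by exists (ran s), [::], s.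
by exists x, xs.
Qed.

Lemma basis_join (A B : set H) g : basis A -> basis B -> A g -> B g ->
  exists C, [/\ basis C, C g & C `<=` A `&` B].
Proof.
move=> [a [bs [s [_ ->]]]] [a' [bs' [t [_ ->]]]].
move=> [x [xs [xa xbs ->]]] [y [yt [ya ybs /germP[xy]]]].
subst y => -[e xe est].
pose c := idem_mul (idem_mul a a') e.
have cE (z : semichar) : z c = [&& z a, z a' & z e] by rewrite !semicharM andbA.
have xc : x c by rewrite cE xa ya xe.
exists (basic c [seq idem_mul b c | b <- bs ++ bs'] s); split.
- exists c, [seq idem_mul b c | b <- bs ++ bs'], s; split=> //.
  by move=> _ /mapP[b _ ->]; rewrite /idem_le -mulgA idemP.
- exists x, xs; split=> // _ /mapP[b + ->]; rewrite semicharM xc andbT mem_cat.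
  by move=> /orP[/xbs|/ybs].
move=> _ [z [zs [zc zb ->]]]; move: (zc); rewrite cE => /and3P[za za' ze].
have zn b : b \in bs ++ bs' -> ~~ z b.
  by move=> /(map_f (idem_mul^~ c)) /zb; rewrite semicharM zc andbT.
split; first by exists z, zs; split=> // b bb; apply: zn; rewrite mem_cat bb.
exists z, (in_dom_eq ze est zs); split=> //.
  by move=> b bb; apply: zn; rewrite mem_cat bb orbT.
by apply/germP; split=> //; exists e.
Qed.

HB.instance Definition _ := @isBaseTopological.Build H (set H) basis id
  basis_cover basis_join.

Definition Psi s : set H := [set g | exists x (xs : in_dom x s), g = germ xs].

(* H^a. Its elements are bisections ("G-sets"), without which they would not
   form an inverse semigroup. *)
Definition in_ample (A : set H) : Prop :=
  [/\ compact A, open A, hausdorff_space (subspace A),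
      set_inj A grange & set_inj A gsource].

End UniversalGroupoid.

Section TopologicalGroupoid.
Variables (G : topologicalType) (comp : G -> G -> Prop) (mul : G -> G -> G) (inv : G -> G).

Definition groupoid_axioms : Prop :=
  [/\ involutive inv,
      (forall g h k, comp g h -> comp h k ->
        [/\ comp (mul g h) k, comp g (mul h k) & mul (mul g h) k = mul g (mul h k)]),
      (forall g, comp (inv g) g /\ comp g (inv g)),
      (forall g h, comp g h -> mul (inv g) (mul g h) = h) &
      (forall g h, comp g h -> mul (mul g h) (inv h) = g)].

Definition locally_compact_groupoid : Prop :=
  [/\ groupoid_axioms,
      {within [set p : G * G | comp p.1 p.2], continuous (fun p => mul p.1 p.2)},
      continuous inv &
      locally_compact [set: G]].

End TopologicalGroupoid.

Record digraph := Digraph {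
  vertex : countType;
  edge : countType;
  esrc : edge -> vertex;
  etgt : edge -> vertex
}.

Definition no_sinks (G : digraph) : Prop :=
  forall v : vertex G, exists e : edge G, esrc e = v.

Section Paths.
Variable G : digraph.
Local Notation V := (vertex G).
Local Notation E := (edge G).

Fixpoint walk (v : V) (l : seq E) : bool :=
  if l is e :: l' then (esrc e == v) && walk (etgt e) l' else true.

Definition walk_end (v : V) (l : seq E) : V := last v (map (@etgt G) l).

Lemma walk_cat v l1 l2 : walk v (l1 ++ l2) = walk v l1 && walk (walk_end v l1) l2.
Proof. by elim: l1 v => //= e l IH v; rewrite IH andbA. Qed.

Lemma walk_end_cat v l1 l2 : walk_end v (l1 ++ l2) = walk_end (walk_end v l1) l2.
Proof. by rewrite /walk_end map_cat last_cat. Qed.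

(* A finite path is its initial vertex with its edge list, so (v, [::]) is the
   path v of length 0. *)
Record finpath := FinPath { fp :> V * seq E; _ : walk fp.1 fp.2 }.
HB.instance Definition _ := [isSub for fp].
HB.instance Definition _ := [Countable of finpath by <:].

Definition fsrc (a : finpath) : V := (val a).1.
Definition fedges (a : finpath) : seq E := (val a).2.
Definition frng (a : finpath) : V := walk_end (fsrc a) (fedges a).
Definition flen (a : finpath) : nat := size (fedges a).

Record infpath := InfPath {
  ip :> nat -> E;
  ipP : forall n, etgt (ip n) = esrc (ip n.+1)
}.

(* Y \cup Z *)
Definition gpath : Type := (finpath + infpath)%type.

Definition gsrc (x : gpath) : V :=
  match x with inl m => fsrc m | inr w => esrc (w 0%N) end.

(* The first n edges, or all of them if there are fewer. *)
Definition gtake (n : nat) (x : gpath) : seq E :=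
  match x with inl m => take n (fedges m) | inr w => mkseq w n end.

Definition initial (a : finpath) (x : gpath) : bool :=
  (fsrc a == gsrc x) && (fedges a == gtake (flen a) x).

Lemma fcat_subproof (a m : finpath) : frng a = fsrc m ->
  walk (fsrc a) (fedges a ++ fedges m).
Proof.
move=> am; rewrite walk_cat; apply/andP; split; first exact: (valP a).
by rewrite -/(frng a) am; exact: (valP m).
Qed.

Definition fcat (a m : finpath) (am : frng a = fsrc m) : finpath :=
  @FinPath (fsrc a, fedges a ++ fedges m) (fcat_subproof am).

Definition icat_fun (a : finpath) (w : infpath) (n : nat) : E :=
  if (n < flen a)%N then nth (w 0%N) (fedges a) n else w (n - flen a)%N.

Lemma walk_nth (e : E) v l n : walk v l -> (n.+1 < size l)%N ->
  etgt (nth e l n) = esrc (nth e l n.+1).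
Proof.
elim: l v n => //= e1 l IH v [|n] /andP[_]; last exact: IH.
by case: l {IH} => //= e2 l /andP[/eqP].
Qed.

Lemma walk_end_nth (e : E) v l n : size l = n.+1 -> walk_end v l = etgt (nth e l n).
Proof.
move=> ln; rewrite /walk_end (last_nth v) size_map ln /=.
by rewrite (nth_map e) ?ln.
Qed.

Lemma icat_subproof (a : finpath) (w : infpath) : frng a = esrc (w 0%N) ->
  forall n, etgt (icat_fun a w n) = esrc (icat_fun a w n.+1).
Proof.
move=> aw n; rewrite /icat_fun; case: (ltnP n.+1 (flen a)) => na1.
  by rewrite ltnW //; exact: (walk_nth _ (valP a)).
case: (ltnP n (flen a)) => na; last by rewrite subSn // ipP.
have an : flen a = n.+1 by apply/eqP; rewrite eqn_leq na1.
by rewrite an subnn -aw /frng (walk_end_nth (w 0%N) _ an).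
Qed.

Definition icat (a : finpath) (w : infpath) (aw : frng a = esrc (w 0%N)) : infpath :=
  InfPath (icat_subproof aw).

Definition gcat (a : finpath) (x : gpath) : frng a = gsrc x -> gpath :=
  match x with
  | inl m => fun am => inl (fcat am)
  | inr w => fun aw => inr (icat aw)
  end.

End Paths.

Section GraphInverseSemigroup.
Variable G : digraph.
Local Notation V := (vertex G).
Local Notation E := (edge G).
Local Notation Y := (finpath G).

Record gpair := GPair { gp :> Y * Y; _ : frng gp.1 == frng gp.2 }.
HB.instance Definition _ := [isSub for gp].
HB.instance Definition _ := [Countable of gpair by <:].

(* None is the zero element z. *)
Definition gis : Type := option gpair.
HB.instance Definition _ := Countable.on gis.

Definition gis_zero : gis := None.

Definition gis_pair (a b : Y) (ab : frng a = frng b) : gis :=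
  Some (@GPair (a, b) (introT eqP ab)).

(* If a is an initial segment of b, then b = a (fresidual a b). *)
Definition fresidual (a b : Y) : Y :=
  insubd b (frng a, drop (flen a) (fedges b)).

(* The default of insubd, and None in the two insub below, are not reached:
   see gis_mul_pairl and gis_mul_pairr. *)
Definition fappend (a m : Y) : Y := insubd a (fsrc a, fedges a ++ fedges m).

Definition gis_mul (s t : gis) : gis :=
  match s, t with
  | Some p, Some q =>
    let: (a, b) := val p in
    let: (c, d) := val q in
    if initial c (inl b) then insub (a, fappend d (fresidual c b))
    else if initial b (inl c) then insub (fappend a (fresidual b c), d)
    else None
  | _, _ => None
  end.

Lemma gis_star_subproof (p : gpair) : frng (val p).2 == frng (val p).1.
Proof. by rewrite eq_sym; exact: (valP p). Qed.

Definition gis_star (s : gis) : gis :=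
  omap (fun p => @GPair ((val p).2, (val p).1) (gis_star_subproof p)) s.

Lemma finpath_eq (a b : Y) : fsrc a = fsrc b -> fedges a = fedges b -> a = b.
Proof.
by move=> h1 h2; apply: val_inj; rewrite [val a]surjective_pairing [val b]surjective_pairing;
  congr pair.
Qed.

Lemma initialE (a b : Y) :
  initial a (inl b) = (fsrc a == fsrc b) && prefix (fedges a) (fedges b).
Proof. by rewrite /initial /= prefixE eq_sym [_ == fedges a]eq_sym eq_sym. Qed.

Lemma initial_fcat (a m : Y) (am : frng a = fsrc m) : initial a (inl (fcat am)).
Proof. by rewrite initialE /= eqxx prefix_prefix. Qed.

Lemma fappendE (a m : Y) (am : frng a = fsrc m) : fappend a m = fcat am.
Proof.
apply: val_inj; rewrite /fappend val_insubd ifT //; exact: fcat_subproof.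
Qed.

Lemma fresidual_fcat (a m : Y) (am : frng a = fsrc m) : fresidual a (fcat am) = m.
Proof.
apply: val_inj; rewrite /fresidual val_insubd /= /flen.
rewrite /fedges /= drop_size_cat // am.
by rewrite ifT; [rewrite -surjective_pairing|exact: (valP m)].
Qed.

Lemma initialP (a b : Y) : initial a (inl b) ->
  exists m (am : frng a = fsrc m), b = fcat am.
Proof.
rewrite initialE => /andP[/eqP sab /prefixP[l bE]].
have wl : walk (frng a) l.
  by have := valP b; rewrite -/(fsrc b) -/(fedges b) bE walk_cat -sab => /andP[].
exists (@FinPath G (frng a, l) wl), erefl.
by apply: finpath_eq; rewrite ?sab.
Qed.

Lemma frng_fcat (a m : Y) (am : frng a = fsrc m) : frng (fcat am) = frng m.
Proof. by rewrite /frng /= walk_end_cat -/(frng a) am. Qed.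

(* Raw words, on which gis acts faithfully by partial injections (a, b) : b m |-> a m. *)
Let W : Type := (V * seq E)%type.

Let strip (b : Y) (w : W) : option (seq E) :=
  if (fsrc b == w.1) && prefix (fedges b) w.2 then Some (drop (flen b) w.2) else None.

Let app (s : gis) (w : W) : option W :=
  if s is Some p then
    omap (fun l => (fsrc (val p).1, fedges (val p).1 ++ l)) (strip (val p).2 w)
  else None.

Let stripP (b : Y) w l : strip b w = Some l <-> w = (fsrc b, fedges b ++ l).
Proof.
rewrite /strip; split.
  case: ifP => // /andP[/eqP -> /prefixP[k wE]] [<-].
  by rewrite [w in LHS]surjective_pairing wE drop_size_cat.
by move=> -> /=; rewrite eqxx prefix_prefix drop_size_cat.
Qed.

Let appP (s : gis) w w' : app s w = Some w' <->
  exists p l, [/\ s = Some p, w = (fsrc (val p).2, fedges (val p).2 ++ l)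
                & w' = (fsrc (val p).1, fedges (val p).1 ++ l)].
Proof.
case: s => [p|] /=; last by split=> // -[p [l []]].
split.
  case sE: (strip _ _) => [l|] //= [<-]; exists p, l; split=> //.
  exact/stripP.
by move=> [_ [l [[<-] /stripP -> ->]]].
Qed.

Let opt_ext (o1 o2 : option W) :
  (forall w, o1 = Some w <-> o2 = Some w) -> o1 = o2.
Proof.
case: o1 => [w|] h; first by apply/esym/h.
by case: o2 h => // w /(_ w)[_ ->].
Qed.

Let app_faithful (s t : gis) : app s =1 app t -> s = t.
Proof.
have sub (p : gpair) (u : gis) : app (Some p) =1 app u -> exists q l,
    [/\ u = Some q, val (val p).2 = (fsrc (val q).2, fedges (val q).2 ++ l) &
        val (val p).1 = (fsrc (val q).1, fedges (val q).1 ++ l)].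
  move=> h; have /appP : app u (val (val p).2) = Some (val (val p).1).
    rewrite -h; apply/appP; exists p, [::]; rewrite !cats0.
    by split=> //; rewrite [LHS]surjective_pairing.
  by [].
case: s t => [p|] [q|] h //.
- have [_ [l [[<-] p2 p1]]] := sub _ _ h.
  have [_ [k [[<-] q2 q1]]] := sub _ _ (fsym h).
  have l0 : l = [::].
    apply/eqP; rewrite -size_eq0 -leqn0.
    have /(congr1 size) : fedges (val p).2 = fedges (val p).2 ++ (k ++ l).
      by rewrite {1}/fedges p2 /= {1}/fedges q2 /= catA.
    rewrite !size_cat -[LHS]addn0 => /addnI/esym/eqP.
    by rewrite addn_eq0 => /andP[_ /eqP ->].
  congr Some; apply: val_inj; rewrite [val p]surjective_pairing [val q]surjective_pairing.
  congr pair; apply: val_inj.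
    by rewrite p1 l0 cats0 -surjective_pairing.
  by rewrite p2 l0 cats0 -surjective_pairing.
- by have [? [? []]] := sub _ _ h.
- by have [? [? []]] := sub _ _ (fsym h).
Qed.

Lemma gis_mul_pairl (a a' b m : Y) (am : frng a' = fsrc m) (h1 : frng a = frng (fcat am))
    (h2 : frng a' = frng b) (bm : frng b = fsrc m) (h3 : frng a = frng (fcat bm)) :
  gis_mul (gis_pair h1) (gis_pair h2) = gis_pair h3.
Proof.
rewrite /gis_mul /= initial_fcat fresidual_fcat (fappendE bm).
by rewrite insubT ?h3 // => h; congr Some; apply: val_inj.
Qed.

Lemma gis_mul_pairr (a a' b m : Y) (am : frng a' = fsrc m) (h1 : frng a = frng a')
    (h2 : frng (fcat am) = frng b) (bm : frng a = fsrc m) (h3 : frng (fcat bm) = frng b) :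
  gis_mul (gis_pair h1) (gis_pair h2) = gis_pair h3.
Proof.
rewrite /gis_mul /=; case: ifP => [h|_].
  have m0 : fedges m = [::].
    move: h; rewrite initialE => /andP[_ /size_prefix /=].
    by rewrite size_cat -[X in (_ <= X)%N]addn0 leq_add2l leqn0 size_eq0 => /eqP.
  have E0 (c : Y) (cm : frng c = fsrc m) : fcat cm = c.
    by apply: finpath_eq => //=; rewrite {1}/fedges /= m0 cats0.
  rewrite [X in fresidual X _](E0 _ am).
  have -> : fappend b (fresidual a' a') = b.
    apply: val_inj; rewrite /fappend val_insubd.
    suff -> : fedges (fresidual a' a') = [::].
      by rewrite cats0 -surjective_pairing (valP b).
    by rewrite /fresidual /fedges val_insubd drop_size /=.
  rewrite insubT; first by rewrite -(E0 _ bm) h3.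
  by move=> h'; congr Some; apply: val_inj => /=; rewrite (E0 _ bm).
rewrite initial_fcat fresidual_fcat (fappendE bm).
by rewrite insubT ?h3 // => h; congr Some; apply: val_inj.
Qed.


Let app_pairP (a b : Y) (ab : frng a = frng b) w w' : app (gis_pair ab) w = Some w' <->
  exists l, w = (fsrc b, fedges b ++ l) /\ w' = (fsrc a, fedges a ++ l).
Proof.
rewrite appP; split; first by move=> [p [l [[<-] -> ->]]]; exists l.
by move=> [l [-> ->]]; do 2 eexists.
Qed.

Let app_mul (s t : gis) w : app (gis_mul s t) w = obind (app s) (app t w).
Proof.
case: s => [p|]; last by case: (app t w).
case: t => [q|] //.
have pE (p0 : gpair) : exists a b (ab : frng a = frng b), Some p0 = gis_pair ab.
  case: p0 => -[a b] /= ab; exists a, b, (eqP ab); congr Some; exact: val_inj.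
have [a [b [ab ->]]] := pE p; have [c [d [cd ->]]] := pE q.
have obindP v' : obind (app (gis_pair ab)) (app (gis_pair cd) w) = Some v' <->
    exists2 v, app (gis_pair cd) w = Some v & app (gis_pair ab) v = Some v'.
  split; first by case: (app _ w) => //= v; exists v.
  by move=> [v -> /=].
apply: opt_ext => w'; rewrite obindP.
case cb: (initial c (inl b)).
  have [m [cm bE]] := initialP cb; subst b.
  have dm : frng d = fsrc m by rewrite -cd.
  have h3 : frng a = frng (fcat dm) by rewrite ab !frng_fcat.
  rewrite (gis_mul_pairl _ _ h3) app_pairP; split.
    move=> [l [-> ->]]; exists (fsrc c, fedges c ++ (fedges m ++ l)).
      by apply/app_pairP; exists (fedges m ++ l); rewrite catA.
    by apply/app_pairP; exists l; rewrite catA.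
  move=> [v /app_pairP[l [-> ->]] /app_pairP[k [/(congr1 snd)/= E1 ->]]].
  have {E1}-> : l = fedges m ++ k.
    by apply/eqP; move/eqP: E1; rewrite /= -catA eqseq_cat // eqxx.
  by exists k; rewrite /= -catA.
case bc: (initial b (inl c)).
  have [m [bm cE]] := initialP bc; subst c.
  have am : frng a = fsrc m by rewrite ab.
  have h3 : frng (fcat am) = frng d by rewrite -cd !frng_fcat.
  rewrite (gis_mul_pairr _ _ h3) app_pairP; split.
    move=> [l [-> ->]]; exists (fsrc b, fedges b ++ (fedges m ++ l)).
      by apply/app_pairP; exists l; rewrite catA.
    by apply/app_pairP; exists (fedges m ++ l); rewrite !catA.
  move=> [v /app_pairP[l [-> ->]] /app_pairP[k [/(congr1 snd)/= E1 ->]]].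
  have {E1}-> : k = fedges m ++ l.
    by apply/eqP; move/eqP: E1; rewrite /= -catA eqseq_cat // eqxx => /eqP ->.
  by exists l; rewrite /= -catA.
have -> : gis_mul (gis_pair ab) (gis_pair cd) = None by rewrite /gis_mul /= cb bc.
split; first by [].
move=> [v /app_pairP[l [_ ->]] /app_pairP[k [E1 _]]].
have sE : fsrc c = fsrc b by case: E1.
have {E1}eE : fedges c ++ l = fedges b ++ k by case: E1.
move: cb bc; rewrite !initialE sE eqxx /= !prefixE.
case/orP: (leq_total (flen b) (flen c)) => bc.
  by rewrite -(takel_cat l bc) eE take_size_cat // eqxx.
by rewrite -(takel_cat k bc) -eE take_size_cat // eqxx.
Qed.

Lemma gis_starK : involutive gis_star.
Proof. by case=> [p|] //=; congr Some; apply: val_inj => /=; rewrite -surjective_pairing. Qed.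

Let app_star (s : gis) w w' : app (gis_star s) w = Some w' <-> app s w' = Some w.
Proof.
suff half f v v' : app (gis_star f) v = Some v' -> app f v' = Some v.
  by split=> [|h]; [exact: half|apply: half; rewrite gis_starK].
case: f => [p|] // /appP[q [l [[<-] -> ->]]].
by apply/appP; exists p, l.
Qed.

Let app_inj (s : gis) w1 w2 w : app s w1 = Some w -> app s w2 = Some w -> w1 = w2.
Proof. by move=> /app_star h1 /app_star; rewrite h1 => -[]. Qed.

Let app_mulP (s t : gis) w w' : app (gis_mul s t) w = Some w' <->
  exists2 v, app t w = Some v & app s v = Some w'.
Proof.
rewrite app_mul; split; first by case: (app t w) => //= v; exists v.
by move=> [v -> /=].
Qed.

Lemma gis_mulA : associative gis_mul.
Proof.
move=> s t u; apply: app_faithful => w; rewrite !app_mul.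
by case: (app u w) => //= v; rewrite app_mul.
Qed.

HB.instance Definition _ := isSemigroup.Build gis gis_mulA.

Lemma gis_mulsgK (s : gis) : gis_mul (gis_mul s (gis_star s)) s = s.
Proof.
apply: app_faithful => w; apply: opt_ext => w'; split.
  by move=> /app_mulP[v sv /app_mulP[u /app_star su su']]; rewrite (app_inj sv su).
move=> sw; apply/app_mulP; exists w' => //; apply/app_mulP; exists w => //.
exact/app_star.
Qed.

Lemma gis_star_unique (s t : gis) :
  gis_mul (gis_mul s t) s = s -> gis_mul (gis_mul t s) t = t -> t = gis_star s.
Proof.
have half (f g : gis) w w' : gis_mul (gis_mul f g) f = f ->
    app f w = Some w' -> app g w' = Some w.
  move=> fgf fw; have := fw; rewrite -{1}fgf => /app_mulP[v fv /app_mulP[u gv fu]].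
  have ? : v = w' by move: fv; rewrite fw => -[].
  by subst v; rewrite (app_inj fw fu).
move=> sts tst; apply: app_faithful => w; apply: opt_ext => w'; rewrite app_star.
by split; exact: half.
Qed.

Lemma gis_mulgsK (s : gis) : gis_mul (gis_mul (gis_star s) s) (gis_star s) = gis_star s.
Proof. by have := gis_mulsgK (gis_star s); rewrite gis_starK. Qed.

HB.instance Definition _ :=
  Semigroup_isInverse.Build gis gis_mulsgK gis_mulgsK gis_star_unique.

Let trunc (n : nat) (x : gpath G) : W := (gsrc x, gtake n x).

Let take_gtake k n (x : gpath G) : (k <= n)%N -> take k (gtake n x) = gtake k x.
Proof.
by case: x => [m|w] kn /=; [exact: take_takel|rewrite -map_take take_iota (minn_idPl kn)].
Qed.

Let initial_trunc (a : Y) (x : gpath G) n : (flen a <= n)%N ->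
  initial a x = isSome (strip a (trunc n x)).
Proof.
by move=> an; rewrite /strip /initial /= prefixE take_gtake // eq_sym [_ == fedges a]eq_sym;
  rewrite [gsrc x == _]eq_sym; case: ifP.
Qed.

Let idem_app (e : idem gis) w v : app (val e) w = Some v -> v = w.
Proof.
move=> ev; have := ev; rewrite -{1}(idemP e) => /app_mulP[u eu].
by move: eu; rewrite ev => -[<-]; move=> h; exact: app_inj h ev.
Qed.

Let idem_diag (e : idem gis) p : val e = Some p -> (val p).1 = (val p).2.
Proof.
move=> ep; have : app (val e) (val (val p).2) = Some (val (val p).1).
  rewrite ep; apply/appP; exists p, [::]; rewrite !cats0.
  by split=> //; rewrite [LHS]surjective_pairing.
by move=> /idem_app /val_inj.
Qed.

(* The idempotents other than z are the (a, a). *)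
Definition gpath_char_fun (x : gpath G) (e : idem gis) : bool :=
  if val e is Some p then initial (val p).1 x else false.

Let idem_len (e : idem gis) : nat := if val e is Some p then flen (val p).1 else 0%N.

Let gpath_char_app x (e : idem gis) n : (idem_len e <= n)%N ->
  gpath_char_fun x e = isSome (app (val e) (trunc n x)).
Proof.
rewrite /gpath_char_fun /idem_len; case ep: (val e) => [p|] // pn.
by rewrite (initial_trunc x pn) /app -(idem_diag ep); case: (strip _ _).
Qed.

Lemma gpath_charM x (e f : idem gis) :
  gpath_char_fun x (idem_mul e f) = gpath_char_fun x e && gpath_char_fun x f.
Proof.
pose n := maxn (idem_len (idem_mul e f)) (maxn (idem_len e) (idem_len f)).
rewrite !(@gpath_char_app _ _ n) ?leq_max ?leqnn ?orbT //.
rewrite [val (idem_mul e f)]/(gis_mul (val e) (val f)) app_mul.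
case fE: (app (val f) _) => [v|]; last by rewrite andbF.
by rewrite /= (idem_app fE) andbT.
Qed.

Lemma gpath_char_neq0 x : exists e, gpath_char_fun x e.
Proof.
pose v : Y := @FinPath G (gsrc x, [::]) isT.
pose s := gis_pair (erefl (frng v)).
have ss : (s * s : gis) == s.
  apply/eqP/app_faithful => w; rewrite (app_mul s s) /=.
  case: w => u l; rewrite /strip /fsrc /fedges /= prefix0s drop0 andbT.
  by case: ifP => _ //=; rewrite /strip /fsrc /fedges /= eqxx prefix0s drop0.
exists (exist _ s ss); rewrite /gpath_char_fun /= /initial /flen /fsrc /fedges /= eqxx.
by case: (x) => [m|w] /=; rewrite ?take0.
Qed.

Definition gpath_char (x : gpath G) : semichar gis :=
  Semichar (gpath_charM x) (gpath_char_neq0 x).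

(* The constant semicharacter 1, i.e. the point z of H^0. *)
Definition one_char : semichar gis :=
  @Semichar gis (fun=> true) (fun _ _ => erefl)
    (ex_intro _ (ran gis_zero) isT).

(* The identification Y \cup Z \cup {z} = H^0, with None for z. *)
Definition unit_char (o : option (gpath G)) : semichar gis :=
  if o is Some x then gpath_char x else one_char.

Definition triple : Type := (gpath G * int * gpath G)%type.

(* A_{a,b}. The point z lies in D_s for every s and its class under (a, b) is
   the unit z, so that Psi (a, b) is A_{a,b} together with z. *)
Definition triple_set (a b : Y) : set triple :=
  [set t | exists x (ax : frng a = gsrc x) (bx : frng b = gsrc x),
    t = (gcat ax, ((flen a)%:Z - (flen b)%:Z)%R, gcat bx)].

Definition triples : set triple := [set t | exists a b, triple_set a b t].

(* In option triple, None is the extra point z. *)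
Implicit Types t u : option triple.

Definition trange t : option (gpath G) := omap (fun p => p.1.1) t.
Definition tsource t : option (gpath G) := omap snd t.

Definition tcomposable t u : Prop :=
  match t, u with
  | Some (_, _, y), Some (y', _, _) => y = y'
  | None, None => True
  | _, _ => False
  end.

Definition tmul t u : option triple :=
  match t, u with
  | Some (x, m, _), Some (_, n, w) => Some (x, (m + n)%R, w)
  | _, _ => None
  end.

Definition tinv t : option triple :=
  omap (fun '(x, m, y) => (y, (- m)%R, x)) t.

End GraphInverseSemigroup.

Arguments gis_zero : clear implicits.
Arguments triples : clear implicits.

(* Main.v *)
Require Import Defs.
From HB Require Import structures.
From mathcomp Require Import all_boot all_order all_algebra.
From mathcomp Require Import all_classical topology zify.

(* A semicharacter x of the graph semilattice is constant 1 as soon as x(z) = 1,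
   and otherwise the paths on which it is 1 are pairwise comparable and closed
   under initial segments, so they are the initial segments of a single element
   of Y \cup Z. The degree l(a) - l(b) is additive on the non-zero products of
   S, hence constant on the germs away from z, and a germ there is determined
   by its range, its source and its degree; this gives the triples. The germs
   at z form a single isolated point. Range, source and degree are locally
   constant functions separating the points of H, so H is Hausdorff. The set
   Psi s is compact in the universal groupoid of any inverse semigroup. *)

Set Implicit Arguments.
Unset Strict Implicit.
Unset Printing Implicit Defensive.

Local Open Scope classical_set_scope.

(** * The universal groupoid of an inverse semigroup *)

Section UniversalGroupoidTheory.
Variable S : invSemigroupType.
Implicit Types (x y : semichar S) (s t : S) (e f : idem S).
Local Open Scope group_scope.
Local Notation H := (univ_groupoid S).

(** * Groupoid axioms for germs *)

Lemma act_star x s (xs : in_dom x s) : act (inv_dom xs) = x.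
Proof.
apply: semichar_ext => e /=.
rewrite (_ : conj s _ = idem_mul (ran s) (idem_mul e (ran s))).
  by rewrite !semicharM (xs : x (ran s)) andbT.
by apply: val_inj => /=; rewrite starK !mulgA.
Qed.

(** The action of [star s] undoes that of [s]. The hypothesis is used at the values
    [conj (star s) e], since [inv_dom xs] and [inv_dom ys] are proofs about different terms. *)
Lemma act_inj x y s (xs : in_dom x s) (ys : in_dom y s) :
  act xs = act ys -> x = y.
Proof.
move=> xys; rewrite -(act_star xs) -(act_star ys).
by apply: semichar_ext => e; rewrite /act /=; move/(congr1 (fun z : semichar S => z (conj (star s) e))): xys.
Qed.

Lemma actM x s t (xs : in_dom x s) (xst : in_dom (act xs) t) :
  act (mul_dom xst) = act xst.
Proof.
apply: semichar_ext => e /=; congr (x _); apply: val_inj => /=.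
by rewrite starM !mulgA.
Qed.

(** A normal form for composable pairs: the second germ is represented at the base point [act xs],
    the shape to which [gmul_germ] applies. *)
Lemma composable_germP (g h : H) : composable g h <->
  exists x s t (xs : in_dom x s) (yt : in_dom (act xs) t), g = germ xs /\ h = germ yt.
Proof.
split; last first.
  by move=> [x [s [t [xs [yt [-> ->]]]]]]; rewrite /composable gsource_germ grange_germ.
have [x [s [xs ->]]] := germ_surj g; have [y [t [yt ->]]] := germ_surj h.
rewrite /composable gsource_germ grange_germ => ?; subst y.
by exists x, s, t, xs, yt.
Qed.

Lemma grange_ginv (g : H) : grange (ginv g) = gsource g.
Proof.
by have [x [s [xs ->]]] := germ_surj g; rewrite ginv_germ grange_germ gsource_germ.
Qed.

Lemma gsource_ginv (g : H) : gsource (ginv g) = grange g.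
Proof.
have [x [s [xs ->]]] := germ_surj g.
by rewrite ginv_germ grange_germ gsource_germ act_star.
Qed.

Lemma ginvK : involutive (@ginv S).
Proof.
move=> g; have [x [s [xs ->]]] := germ_surj g.
rewrite !ginv_germ; apply/germP; split; first exact: act_star.
by exists (ran s); rewrite ?starK // act_star.
Qed.

Lemma grange_gmul (g h : H) : composable g h -> grange (gmul g h) = grange g.
Proof.
move=> /composable_germP[x [s [t [xs [yt [-> ->]]]]]].
by rewrite (gmul_germ _ (mul_dom yt)) !grange_germ.
Qed.

Lemma gsource_gmul (g h : H) : composable g h -> gsource (gmul g h) = gsource h.
Proof.
move=> /composable_germP[x [s [t [xs [yt [-> ->]]]]]].
by rewrite (gmul_germ _ (mul_dom yt)) !gsource_germ actM.
Qed.

Lemma gmulA (g h k : H) : composable g h -> composable h k ->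
  gmul (gmul g h) k = gmul g (gmul h k).
Proof.
move=> /composable_germP[x [s [t [xs [yt [-> ->]]]]]].
have [z [u [zu ->]]] := germ_surj k.
rewrite /composable gsource_germ grange_germ => ?; subst z.
(* [act (mul_dom yt)] and [act yt] agree only through [actM], so the germ of [u] is moved to the
   first base point for the left-hand product and back for the right-hand one. *)
have zu' : in_dom (act (mul_dom yt)) u by rewrite actM.
have -> : germ zu = germ zu'.
  by apply/germP; rewrite actM; split=> //; exists (ran u).
rewrite (gmul_germ _ (mul_dom yt)) (gmul_germ _ (mul_dom zu')).
have -> : germ zu' = germ zu.
  by apply/germP; rewrite actM; split=> //; exists (ran u).
have w := mul_dom zu; have w' := mul_dom w.
rewrite (gmul_germ _ w) (gmul_germ _ w'); apply/germP; split=> //.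
by exists (ran s); rewrite ?mulgA.
Qed.

Lemma gmulKg (g h : H) : composable g h -> gmul (ginv g) (gmul g h) = h.
Proof.
move=> /composable_germP[x [s [t [xs [yt [-> ->]]]]]].
have zt : in_dom (act (inv_dom xs)) (s * t) by rewrite act_star; exact: mul_dom yt.
rewrite (gmul_germ _ (mul_dom yt)) ginv_germ.
have -> : germ (mul_dom yt) = germ zt.
  by apply/germP; rewrite act_star; split=> //; exists (ran s).
rewrite (gmul_germ _ (mul_dom zt)); apply/germP; split=> //.
exists (ran (star s)); last by rewrite /= starK !mulgA mulsgK.
exact: inv_dom.
Qed.

Lemma gmulgK (g h : H) : composable g h -> gmul (gmul g h) (ginv h) = g.
Proof.
move=> /composable_germP[x [s [t [xs [yt [-> ->]]]]]].
have zt : in_dom (act (mul_dom yt)) (star t) by rewrite actM; exact: inv_dom.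
rewrite (gmul_germ _ (mul_dom yt)) ginv_germ.
have -> : germ (inv_dom yt) = germ zt.
  by apply/germP; rewrite actM; split=> //; exists (ran (star t)) => //; exact: (inv_dom yt).
rewrite (gmul_germ _ (mul_dom zt)); apply/germP; split=> //.
(* This is the range idempotent of [s * t]; on it [s * t * star t] and [s] agree because
   [t * star t] commutes with [star s * s]. *)
exists (conj s (ran t)) => //.
transitivity (s * (t * star t * (star s * s)) * (t * star t)).
  by rewrite /= !mulgA.
rewrite (idemC (idem_ran t) (idem_dom s)).
transitivity (s * (star s * s * (t * star t * (t * star t)))); first by rewrite !mulgA.
by rewrite idem_ran -(idemC (idem_ran t) (idem_dom s)) /= !mulgA.
Qed.

Lemma univ_groupoid_axioms :
  groupoid_axioms (@composable S) (@gmul S) (@ginv S).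
Proof.
split.
- exact: ginvK.
- move=> g h k gh hk; rewrite gmulA // /composable gsource_gmul // grange_gmul //.
- by move=> g; rewrite /composable gsource_ginv grange_ginv.
- exact: gmulKg.
- exact: gmulgK.
Qed.

(** * Topology of the groupoid of germs *)

(* The neighbourhood filter of x for the topology of pointwise convergence. *)
Definition char_nbhs x : set_system (semichar S) :=
  [set P | exists (a : idem S) (bs : seq (idem S)),
    [/\ x a, {in bs, forall b, ~~ x b} &
        forall y, y a -> {in bs, forall b, ~~ y b} -> P y]].

#[global] Instance char_nbhs_filter x : Filter (char_nbhs x).
Proof.
split.
- by have [a xa] := semichar_neq0 x; exists a, [::].
- move=> P Q [a [bs [xa xbs aP]]] [b [cs [xb xcs bQ]]].
  exists (idem_mul a b), (bs ++ cs); split.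
  + by rewrite semicharM xa.
  + by move=> c; rewrite mem_cat => /orP[/xbs|/xcs].
  move=> y; rewrite semicharM => /andP[ya yb] ycs; split.
    by apply: aP => // c cbs; apply: ycs; rewrite mem_cat cbs.
  by apply: bQ => // c cbs; apply: ycs; rewrite mem_cat cbs orbT.
- by move=> P Q PQ [a [bs [xa xbs aP]]]; exists a, bs; split=> // y ya /(aP _ ya)/PQ.
Qed.

Lemma char_nbhs_eval x e : char_nbhs x [set y | y e = x e].
Proof.
have [a xa] := semichar_neq0 x; case xe: (x e).
  by exists e, [::].
exists a, [:: e]; split=> // [b|y _ /(_ e)]; first by rewrite inE => /eqP ->; rewrite xe.
by rewrite inE eqxx => /(_ isT)/negbTE.
Qed.

(** Continuity of x.s in x: the set given by [a] and [bs] pulls back to the one given by their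
    conjugates under [s]. *)
Lemma char_nbhs_act x s (xs : in_dom x s) (P : set (semichar S)) :
  char_nbhs (act xs) P -> char_nbhs x [set y | forall ys : in_dom y s, P (act ys)].
Proof.
move=> [a [bs [xa xbs aP]]]; exists (conj s a), [seq conj s b | b <- bs]; split=> //.
  by move=> _ /mapP[b /xbs ? ->].
by move=> y ya yb ys; apply: aP => // b /(map_f (conj s))/yb.
Qed.

(** On germs of a fixed [s] the topology is that of the base points, since any other representative
    [t] agrees with [s] on some D_e with x(e) = 1. Neighbourhoods in H are handled below through
    this reduction to [char_nbhs]. *)
Lemma nbhs_germ x s (xs : in_dom x s) (A : set H) :
  nbhs (germ xs) A <-> char_nbhs x [set y | forall ys : in_dom y s, A (germ ys)].
Proof.
rewrite nbhsE /=; split.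
  move=> [_ [[D DB <-] [B DB' Bx]] BA].
  have [a [bs [t [_ BE]]]] := DB _ DB'; rewrite /= BE in Bx.
  have {BA}BA : basic a bs t `<=` A by move=> g Bg; apply: BA; exists B => //=; rewrite BE.
  have [x1 [xt [xa xbs /germP[x1E [e xe est]]]]] := Bx; subst x1.
  exists (idem_mul a e), bs; split=> //; first by rewrite semicharM xa.
  move=> y; rewrite semicharM => /andP[ya ye] yb ys; apply: BA.
  exists y, (in_dom_eq ye est ys); split=> //.
  by apply/germP; split=> //; exists e.
move=> [a [bs [xa xbs aA]]].
pose c := idem_mul a (ran s).
have cE y : y c = y a && in_dom y s by rewrite semicharM.
(* Multiplying each [b] by [c] meets the requirement of [basis] that exclusions lie below [c], and
   changes no value where [c] takes the value 1. *)
exists (basic c [seq idem_mul b c | b <- bs] s); last first.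
  move=> _ [y [ys [yc yb ->]]]; move: (yc); rewrite cE => /andP[ya _].
  apply: aA => // b /(map_f (fun b => idem_mul b c))/yb.
  by rewrite semicharM yc andbT.
split; last first.
  exists x, xs; split=> //; first by rewrite cE xa.
  by move=> _ /mapP[b /xbs xb ->]; rewrite semicharM (negbTE xb).
exists [set basic c [seq idem_mul b c | b <- bs] s]; last by rewrite bigcup_set1.
move=> _ ->; exists c, [seq idem_mul b c | b <- bs], s; split=> //.
by move=> _ /mapP[b _ ->]; rewrite /idem_le -mulgA idemP.
Qed.

Lemma open_Psi s : open (Psi s).
Proof.
rewrite openE => _ [x [xs ->]]; apply/nbhs_germ.
by apply: filterE => y ys; exists y, ys.
Qed.

Lemma continuous_ginv : continuous (@ginv S).
Proof.
move=> g; have [x [s [xs ->]]] := germ_surj g; rewrite /continuous_at ginv_germ => A /nbhs_germ Axs.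
apply/nbhs_germ; move/char_nbhs_act: Axs; apply: filterS => y yA ys /=.
by rewrite ginv_germ; exact: yA.
Qed.

Lemma continuous_gmul : {within [set p : H * H | composable p.1 p.2],
  continuous (fun p => gmul p.1 p.2)}.
Proof.
apply/subspace_continuousP => -[g h] /= /composable_germP[x [s [t [xs [yt [-> ->]]]]]].
rewrite /from_subspace /= (gmul_germ _ (mul_dom yt)) => A /nbhs_germ Axst.
(* The first factor is restricted to germs of [s] at base points where the germ of [s * t] lies in
   [A]; composability then forces the base point of the second factor. *)
exists ([set g | exists y (ys : in_dom y s),
    g = germ ys /\ forall yst : in_dom y (s * t), A (germ yst)], Psi t).
  split; last by apply: open_nbhs_nbhs; split; [exact: open_Psi|exists (act xs), yt].
  by apply/nbhs_germ; move: Axst; apply: filterS => y yA ys; exists y, ys.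
move=> [_ _] /= [[y [ys [-> yA]]] [z [zt ->]]] /=.
rewrite /composable gsource_germ grange_germ => ?; subst z.
by rewrite (gmul_germ _ (mul_dom zt)).
Qed.

Lemma nbhs_grange e (g : H) : nbhs g [set h | grange h e = grange g e].
Proof.
have [x [s [xs ->]]] := germ_surj g; apply/nbhs_germ.
apply: filterS (char_nbhs_eval x e) => y yx ys /=; by rewrite !grange_germ.
Qed.

Lemma nbhs_gsource e (g : H) : nbhs g [set h | gsource h e = gsource g e].
Proof.
have : nbhs g (@ginv S @^-1` [set h | grange h e = grange (ginv g) e]).
  by apply: continuous_ginv; exact: nbhs_grange.
by apply: filterS => h /=; rewrite !grange_ginv.
Qed.

(* An ultrafilter U on Psi s converges to the germ of s at the semicharacter
   e |-> U (D_e). *)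
Lemma compact_Psi s : compact (Psi s).
Proof.
rewrite compact_ultra => U UU Us.
pose xf e : bool := `[< U [set g | grange g e] >].
have xM e f : xf (idem_mul e f) = xf e && xf f.
  apply/asboolP/andP => [Uef|[/asboolP Ue /asboolP Uf]].
    by split; apply/asboolP; move: Uef; apply: filterS => g /=; rewrite semicharM => /andP[].
  by apply: filterS (filterI Ue Uf) => g [/= ge gf]; rewrite semicharM ge.
have xs : xf (ran s).
  by apply/asboolP; apply: filterS Us => _ [y [ys ->]] /=; rewrite grange_germ.
pose x := Semichar xM (ex_intro (fun e => xf e : Prop) (ran s) xs).
have xs' : in_dom x s := xs.
exists (germ xs'); split; first by exists x, xs'.
move=> A /nbhs_germ[a [bs [xa xbs aA]]].
(* Induction over [bs]: for each [b] the ultrafilter contains D_b or its complement, and [xbs] rules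
   out the first. *)
have Ubs : U [set g | {in bs, forall b, ~~ grange g b}].
  elim: bs xbs {aA} => [|b bs IH] xbs; first by apply: filterE.
  have Ub : U [set g | ~~ grange g b].
    have [|] := in_ultra_setVsetC [set g | grange g b] UU.
      by move=> Ub; have /negP[] := xbs b (mem_head _ _); apply/asboolP.
    by apply: filterS => g /= /negP.
  have {}IH := IH (fun c cbs => xbs c (mem_behead (s := b :: bs) cbs)).
  apply: filterS (filterI Ub IH) => g [/= gb gbs] c.
  by rewrite inE => /orP[/eqP ->|/gbs].
move/asboolP: xa => Ua; apply: filterS (filterI Us (filterI Ua Ubs)) => _ [[y [ys ->]] [/= ya yb]].
rewrite grange_germ in ya yb; exact: aA.
Qed.

(** A germ of [s] is determined by its base point, and the base point by the source through
    [act_inj]. *)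
Lemma Psi_bisection s : set_inj (Psi s) (@grange S) /\ set_inj (Psi s) (@gsource S).
Proof.
have key (g h : H) : Psi s g -> Psi s h -> grange g = grange h -> g = h.
  move=> [x [xs ->]] [y [ys ->]]; rewrite !grange_germ => ?; subst y.
  by apply/germP; split=> //; exists (ran s).
split=> g h; rewrite !inE => gs hs; first exact: key.
move=> gh; apply: key => //; move: gs hs gh => [x [xs ->]] [y [ys ->]].
by rewrite !gsource_germ !grange_germ; exact: act_inj.
Qed.

End UniversalGroupoidTheory.

(** * Consequences of the Hausdorff property *)

Lemma hausdorff_subspace (T : topologicalType) (A : set T) :
  hausdorff_space T -> hausdorff_space (subspace A).
Proof.
(* The topology of [subspace A] refines that of [T], so neighbourhoods in [T] remain
   neighbourhoods. *)
move=> hT p q pq; apply: hT => B C pB qC; apply: pq.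
  have := @nbhs_subspace_subset T A setT p (@subsetT _ _); apply.
  by rewrite nbhs_subspaceT.
have := @nbhs_subspace_subset T A setT q (@subsetT _ _); apply.
by rewrite nbhs_subspaceT.
Qed.

Lemma Psi_ample (S : invSemigroupType) (s : S) :
  hausdorff_space (univ_groupoid S) -> in_ample (Psi s).
Proof.
move=> hS; have [? ?] := Psi_bisection s.
split=> //; [exact: compact_Psi|exact: open_Psi|exact: hausdorff_subspace].
Qed.

Lemma univ_groupoid_locally_compact (S : invSemigroupType) :
  hausdorff_space (univ_groupoid S) ->
  locally_compact_groupoid (@composable S) (@gmul S) (@ginv S).
Proof.
move=> hS; split.
- exact: univ_groupoid_axioms.
- exact: continuous_gmul.
- exact: continuous_ginv.
move=> g _; have [x [s [xs gE]]] := germ_surj g.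
have gPsi : nbhs g (Psi s).
  by apply: open_nbhs_nbhs; split; [exact: open_Psi|exists x, xs].
exists (Psi s); first by apply: filterS gPsi => h hs _.
by split; [exact: compact_Psi|apply: compact_closed => //; exact: compact_Psi].
Qed.

(** * Finite and infinite paths *)

Section GraphPaths.
Variable G : digraph.
Local Notation Y := (finpath G).
Implicit Types (a b c m : Y) (x y : gpath G).

Lemma infpath_ext (w w' : infpath G) : w =1 w' -> w = w'.
Proof.
case: w w' => [w wP] [w' wP'] /= /funext ww'; rewrite ww' in wP *.
by congr InfPath; exact: Prop_irrelevance.
Qed.

Lemma take_gtake k n x : (k <= n)%N -> take k (gtake n x) = gtake k x.
Proof.
by case: x => [m|w] kn /=; [exact: take_takel|rewrite -map_take take_iota (minn_idPl kn)].
Qed.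

Lemma initialxx a : initial a (inl a).
Proof. by rewrite initialE eqxx prefix_refl. Qed.

Lemma initial_anti a b : initial a (inl b) -> (flen b <= flen a)%N -> a = b.
Proof.
move=> /andP[/eqP sab /eqP eab] ba; apply: finpath_eq => //.
by rewrite eab /= take_oversize.
Qed.

Lemma initial_trans a b x : initial a (inl b) -> initial b x -> initial a x.
Proof.
rewrite initialE => /andP[/eqP sab /[dup] /size_prefix ab].
rewrite prefixE => /eqP eab /andP[/eqP sb /eqP eb].
by rewrite /initial sab sb eqxx /= -eab eb take_gtake.
Qed.

Lemma initial_comparable a b x : initial a x -> initial b x ->
  (flen a <= flen b)%N -> initial a (inl b).
Proof.
move=> /andP[/eqP sa /eqP ea] /andP[/eqP sb /eqP eb] ab.
by rewrite initialE sa sb eqxx /= prefixE eb take_gtake // -ea.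
Qed.

Lemma gsrc_gcat a x (ax : frng a = gsrc x) : gsrc (gcat ax) = fsrc a.
Proof.
case: x ax => [m|w] //= aw; rewrite /icat_fun /flen; move: aw (valP a).
rewrite /frng /flen -/(fsrc a) -/(fedges a).
by case: (fedges a) => [|e l] //= _ /andP[/eqP].
Qed.

Lemma gtake_gcat a x (ax : frng a = gsrc x) n :
  gtake (flen a + n) (gcat ax) = fedges a ++ gtake n x.
Proof.
case: x ax => [m|w] /= aw; first by rewrite take_cat ltnNge leq_addr /= addKn.
rewrite /mkseq iotaD map_cat add0n; congr cat.
  apply: (@eq_from_nth _ (w 0%N)); rewrite size_map size_iota // => i ia.
  by rewrite (nth_map 0%N) ?size_iota // nth_iota // /icat_fun ia.
rewrite -[X in iota X]addn0 iotaDl -map_comp; apply: eq_map => i /=.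
by rewrite /icat_fun ltnNge leq_addr /= addKn.
Qed.

Lemma initial_gcat a x (ax : frng a = gsrc x) : initial a (gcat ax).
Proof.
rewrite /initial gsrc_gcat -[X in gtake X]addn0 gtake_gcat eqxx /=.
by case: x {ax} => [m|w]; rewrite /= ?take0 cats0.
Qed.

Lemma initial_fcat_gcat a m x (am : frng a = fsrc m) (ax : frng a = gsrc x) :
  initial (fcat am) (gcat ax) = initial m x.
Proof.
rewrite /initial gsrc_gcat -am ax eqxx /flen /= size_cat gtake_gcat.
by rewrite eqxx /fedges /= eqseq_cat // eqxx.
Qed.

Lemma initial_gcatP a x : initial a x -> exists y (ay : frng a = gsrc y), x = gcat ay.
Proof.
case: x => [b /initialP[m [am ->]]|w]; first by exists (inl m), am.
move=> /andP[/eqP sa /eqP ea].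
(* The remaining factor is the tail of [w] after its first [flen a] edges. *)
pose w' := @InfPath G (fun n => w (flen a + n)%N) (fun n => etrans (ipP w _)
  (congr1 (fun k => esrc (w k)) (esym (addnS _ _)))).
have aw : frng a = esrc (w' 0%N).
  rewrite /= addn0 /frng; case aE: (flen a) => [|n].
    by rewrite sa (size0nil aE).
  by rewrite (walk_end_nth (w 0%N) _ aE) ea aE nth_mkseq // ipP.
exists (inr w'), aw; congr inr; apply: infpath_ext => n /=; rewrite /icat_fun.
case: ltnP => na; last by rewrite /w' /= subnKC.
by rewrite ea nth_mkseq.
Qed.

Lemma walk_mkseq (w : infpath G) n : walk (esrc (w 0%N)) (mkseq w n).
Proof.
elim: n => // n IH; rewrite mkseqS -cats1 walk_cat IH /= andbT.
case: n {IH} => [|n]; first by rewrite /walk_end.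
by rewrite (@walk_end_nth _ (w 0%N) _ _ n) ?size_mkseq // nth_mkseq // ipP.
Qed.

(** Truncations test how long a path is and recover its edges; a finite path with fewer than [n]
    edges is its own truncation. *)
Lemma finpath_prefix x n : exists2 a, initial a x & fedges a = gtake n x.
Proof.
case: x => [m|w]; last first.
  exists (@FinPath G (esrc (w 0%N), mkseq w n) (walk_mkseq w n)) => //.
  by rewrite /initial eqxx /= /flen size_mkseq.
have wm : walk (fsrc m) (take n (fedges m)).
  by have := valP m; rewrite -[(val m).2](cat_take_drop n) walk_cat => /andP[].
exists (@FinPath G (fsrc m, take n (fedges m)) wm) => //.
by rewrite initialE eqxx /= /fedges /= prefixE size_take_min take_min take_size.
Qed.

End GraphPaths.

(** * Semicharacters and germs of the graph inverse semigroup *)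

Section GraphSemigroup.
Variable G : digraph.
Local Notation Y := (finpath G).
Local Notation S := (gis G).
Implicit Types (a b c d m : Y) (s t : S) (e f : idem S) (x y : semichar S).
Local Open Scope group_scope.

Lemma gisP s : s = gis_zero G \/ exists a b (ab : frng a = frng b), s = gis_pair ab.
Proof.
case: s => [[[a b] /= ab]|]; [right|by left].
by exists a, b, (eqP ab); congr Some; exact: val_inj.
Qed.

Lemma gis_mulE s t : s * t = gis_mul s t.
Proof. by []. Qed.

Lemma gis_pair_congr a b a' b' (ab : frng a = frng b) (ab' : frng a' = frng b') :
  a = a' -> b = b' -> gis_pair ab = gis_pair ab'.
Proof. by move=> aa' bb'; congr Some; apply: val_inj; rewrite /= aa' bb'. Qed.

Lemma gis_pairM a b c (ab : frng a = frng b) (bc : frng b = frng c) (ac : frng a = frng c) :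
  gis_pair ab * gis_pair bc = gis_pair ac.
Proof.
(* Writing [b] as [b] followed by the path of length 0 at its end makes the product a case of
   [gis_mul_pairl]. *)
pose v : Y := @FinPath G (frng b, [::]) isT.
have catv d (dv : frng d = fsrc v) : fcat dv = d.
  by apply: finpath_eq => //; exact: cats0.
have bv : frng b = fsrc v by [].
have cv : frng c = fsrc v by rewrite -bc.
have abv : frng a = frng (fcat bv) by rewrite catv.
have acv : frng a = frng (fcat cv) by rewrite catv.
rewrite (gis_pair_congr ab abv) ?catv // [LHS](gis_mul_pairl abv bc acv).
by apply: gis_pair_congr; rewrite ?catv.
Qed.

Definition zidem : idem S := ran (gis_zero G).

Definition pidem a : idem S :=
  exist _ (gis_pair (erefl (frng a))) (introT eqP (gis_pairM _ _ _)).

Lemma ran_pair a b (ab : frng a = frng b) : ran (gis_pair ab) = pidem a.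
Proof.
apply: val_inj; rewrite /= -(gis_pairM ab (esym ab)); congr (_ * _).
by congr Some; exact: val_inj.
Qed.

Lemma idem_gisP e : e = zidem \/ exists a, e = pidem a.
Proof.
have [e0|[a [b [ab eE]]]] := gisP (val e); [left|right].
  by apply: val_inj; rewrite e0.
(* An idempotent is its own star, and the star of (a, b) is (b, a), so a = b. *)
exists a; apply: val_inj; rewrite eE; have := star_idem (idemP e).
by rewrite eE => -[ba _]; apply: gis_pair_congr.
Qed.

Lemma pidemM_pair a b m (am : frng a = fsrc m) (bm : frng b = fsrc m)
    (ab : frng a = frng b) (abm : frng (fcat am) = frng (fcat bm)) :
  val (pidem (fcat am)) * gis_pair ab = gis_pair abm.
Proof. exact: gis_mul_pairl. Qed.

Lemma pair_pidemM a b m (am : frng a = fsrc m) (bm : frng b = fsrc m)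
    (ab : frng a = frng b) (abm : frng (fcat am) = frng (fcat bm)) :
  gis_pair ab * val (pidem (fcat bm)) = gis_pair abm.
Proof. exact: gis_mul_pairr. Qed.

Lemma star_pair a b (ab : frng a = frng b) : star (gis_pair ab) = gis_pair (esym ab).
Proof. by congr Some; exact: val_inj. Qed.

(** With [conj_pidem_initial] this gives the action of (a, b): a path extending [b] has its segment
    [b] replaced by [a], and an initial segment of [b] is sent to [a]. *)
Lemma conj_pidem_fcat a b m (am : frng a = fsrc m) (bm : frng b = fsrc m)
    (ab : frng a = frng b) : conj (gis_pair ab) (pidem (fcat bm)) = pidem (fcat am).
Proof.
have abm : frng (fcat am) = frng (fcat bm) by rewrite !frng_fcat.
apply: val_inj; rewrite /= (pair_pidemM _ abm) star_pair.
exact: gis_mul_pairl.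
Qed.

Lemma conj_pidem_initial a b c (ab : frng a = frng b) : initial c (inl b) ->
  conj (gis_pair ab) (pidem c) = pidem a.
Proof.
move=> /initialP[m [cm bE]]; subst b; apply: val_inj => /=.
rewrite [gis_pair ab * _](gis_mul_pairl ab (erefl (frng c)) ab) star_pair.
exact: gis_pairM.
Qed.

Lemma pidemM_initial a b : initial a (inl b) -> idem_mul (pidem a) (pidem b) = pidem b.
Proof.
move=> /initialP[m [am bE]]; subst b; apply: val_inj.
exact: (pair_pidemM (erefl (frng a)) (erefl (frng (fcat am)))).
Qed.

Lemma pidemM_eq0 a b : ~~ initial a (inl b) -> ~~ initial b (inl a) ->
  idem_mul (pidem a) (pidem b) = zidem.
Proof.
move=> ab ba; apply: val_inj; rewrite /= gis_mulE.
by rewrite /gis_mul /= (negbTE ab) (negbTE ba).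
Qed.

(** * Values of a semicharacter on paths *)

Lemma semichar_zidem x : x zidem -> x = one_char G.
Proof.
move=> x0; apply: semichar_ext => e /=.
suff : x (idem_mul zidem e) by rewrite semicharM => /andP[].
by rewrite (_ : idem_mul _ _ = zidem) //; exact: val_inj.
Qed.

Lemma semichar_initial x a b : initial a (inl b) -> x (pidem b) -> x (pidem a).
Proof. by move=> /pidemM_initial <-; rewrite semicharM => /andP[]. Qed.

(** Incomparable paths have product zero, where [x] vanishes; of two comparable ones the shorter is
    initial in the longer. *)
Lemma semichar_comparable x a b : ~~ x zidem -> x (pidem a) -> x (pidem b) ->
  (flen a <= flen b)%N -> initial a (inl b).
Proof.
move=> x0 xa xb ab; apply: contraNT x0 => nab.
rewrite -(pidemM_eq0 nab) ?semicharM ?xa //.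
by apply: contra nab => ba; rewrite -(initial_anti ba ab) initialxx.
Qed.

(** The integer entry of a triple, computed from a representative of the germ. The value 0 at the
    zero element is a default; [gis_degM] is stated for non-zero products only. *)
Definition gis_deg s : int :=
  if s is Some p then ((flen (val p).1)%:Z - (flen (val p).2)%:Z)%R else 0%R.

Lemma flen_fcat a m (am : frng a = fsrc m) : flen (fcat am) = (flen a + flen m)%N.
Proof. exact: size_cat. Qed.

Lemma gis_degM s t : s * t <> gis_zero G ->
  gis_deg (s * t) = (gis_deg s + gis_deg t)%R.
Proof.
have [->|[a [b [ab ->]]]] := gisP s; first by [].
have [->|[c [d [cd ->]]]] := gisP t; first by [].
case cb: (initial c (inl b)).
  have [m [cm bE]] := initialP cb; subst b; move=> _.
  have dm : frng d = fsrc m by rewrite -cd.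
  have h : frng a = frng (fcat dm) by rewrite ab !frng_fcat.
  by rewrite [_ * _](gis_mul_pairl ab cd h) /= !flen_fcat; lia.
case bc: (initial b (inl c)).
  have [m [bm cE]] := initialP bc; subst c; move=> _.
  have am : frng a = fsrc m by rewrite ab.
  have h : frng (fcat am) = frng d by rewrite -cd !frng_fcat.
  by rewrite [_ * _](gis_mul_pairr ab cd h) /= !flen_fcat; lia.
by case; rewrite gis_mulE /gis_mul /= cb bc.
Qed.

Lemma gis_deg_star s : gis_deg (star s) = (- gis_deg s)%R.
Proof. by case: s => [p|] //=; lia. Qed.

Lemma gis_deg_idem e : gis_deg (val e) = 0%R.
Proof. by have [->|[a ->]] := idem_gisP e => //=; lia. Qed.

Lemma in_dom_neq0 x s : ~~ x zidem -> in_dom x s -> s <> gis_zero G.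
Proof. by move=> /negP x0 xs s0; apply: x0; rewrite s0 in xs. Qed.

(** When x(z) = 0, [val e * s] is non-zero because [x] lies in its domain; idempotents have degree
    0, so it has the degree of [s]. *)
Lemma gis_deg_germ x s t e : ~~ x zidem -> in_dom x s -> x e ->
  val e * s = val e * t -> gis_deg s = gis_deg t.
Proof.
move=> x0 xs xe est.
have xes : in_dom x (val e * s).
  by apply: (in_dom_eq xe _ xs); rewrite mulgA idemP.
have xet : in_dom x (val e * t) by rewrite -est.
have := congr1 gis_deg est.
by rewrite !gis_degM ?gis_deg_idem ?GRing.add0r //; [exact: (in_dom_neq0 x0 xet)|exact: (in_dom_neq0 x0 xes)].
Qed.

Lemma act_zidem x s (xs : in_dom x s) : act xs zidem = x zidem.
Proof.
by congr (x _); apply: val_inj; have [->|[a [b [ab ->]]]] := gisP s.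
Qed.

(** The left entries [a] and [c] are comparable, so up to symmetry c = am. At the source, [bm] and
    [d] both take the value 1 and have equal length by the degree, so they coincide, and (am, bm) is
    a restriction of (a, b). *)
Lemma germ_eq x s t (xs : in_dom x s) (xt : in_dom x t) : ~~ x zidem ->
  act xs = act xt -> gis_deg s = gis_deg t -> germ xs = germ xt.
Proof.
move=> x0; have [s0|[a [b [ab sE]]]] := gisP s; first by case: (in_dom_neq0 x0 xs).
have [t0|[c [d [cd tE]]]] := gisP t; first by case: (in_dom_neq0 x0 xt).
subst s t; wlog ac : a b ab c d cd xs xt / (flen a <= flen c)%N.
  move=> h; have [|ca] := leqP (flen a) (flen c); first exact: h.
  by move=> /esym e1 /esym e2; apply/esym/h => //; exact: ltnW.
move=> sact sdeg.
have xa : x (pidem a) by rewrite -(ran_pair ab).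
have xc : x (pidem c) by rewrite -(ran_pair cd).
have /initialP[m [am cE]] := semichar_comparable x0 xa xc ac; subst c.
have bm : frng b = fsrc m by rewrite -ab.
have abm : frng (fcat am) = frng (fcat bm) by rewrite !frng_fcat.
suff dE : d = fcat bm.
  apply/germP; split=> //; exists (pidem (fcat am)) => //.
  by rewrite (pidemM_pair _ abm) [RHS]gis_pairM; exact: gis_pair_congr.
have yb : act xs (pidem (fcat bm)) by rewrite /= conj_pidem_fcat.
have yd : act xs (pidem d).
  by rewrite sact /= conj_pidem_initial ?initialxx.
have y0 : ~~ act xs zidem by rewrite act_zidem.
have bd : flen (fcat bm) = flen d.
  by move: sdeg; rewrite /= !flen_fcat; lia.
by apply/esym/initial_anti; rewrite ?bd //; apply: semichar_comparable yb yd _; rewrite ?bd.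
Qed.

(** * The unit space as paths together with z *)

Lemma gpath_char_pidem (p : gpath G) a : gpath_char p (pidem a) = initial a p.
Proof. by []. Qed.

Lemma semichar_gis_ext x y : x zidem = y zidem ->
  (forall a, x (pidem a) = y (pidem a)) -> x = y.
Proof.
by move=> xy0 xy; apply: semichar_ext => e; have [->|[a ->]] := idem_gisP e.
Qed.

(** An initial segment [c] of bp is compared with [b]: if it is shorter, conjugation yields [a]; if
    longer, it is some bm, and am is initial in ap. *)
Lemma act_gcat_half a b (p : gpath G) (ab : frng a = frng b) (ap : frng a = gsrc p)
    (bp : frng b = gsrc p) e :
  gpath_char (gcat bp) e -> gpath_char (gcat ap) (conj (gis_pair ab) e).
Proof.
have [->|[c ->]] := idem_gisP e; first by [].
rewrite gpath_char_pidem => cp; case/orP: (leq_total (flen c) (flen b)) => cb.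
  rewrite conj_pidem_initial ?gpath_char_pidem ?initial_gcat //.
  exact: initial_comparable cp (initial_gcat _) cb.
have /initialP[m [bm cE]] := initial_comparable (initial_gcat bp) cp cb; subst c.
have am : frng a = fsrc m by rewrite ab.
by rewrite (conj_pidem_fcat am) gpath_char_pidem initial_fcat_gcat -(initial_fcat_gcat bm bp).
Qed.

(* The converse of act_gcat_half follows from act_gcat_half for (b, a), since
   x.s.s^* = x. *)
Lemma act_gcat a b (p : gpath G) (ab : frng a = frng b) (ap : frng a = gsrc p)
    (bp : frng b = gsrc p) (xs : in_dom (gpath_char (gcat ap)) (gis_pair ab)) :
  act xs = gpath_char (gcat bp).
Proof.
apply: semichar_ext => e; apply/idP/idP; last exact: act_gcat_half.
move=> /(act_gcat_half (esym ab) bp).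
rewrite (_ : conj _ _ = idem_mul (ran (star (gis_pair ab)))
    (idem_mul e (ran (star (gis_pair ab))))).
  by rewrite !semicharM => /and3P[].
by apply: val_inj; rewrite /= starK -star_pair starK !mulgA.
Qed.

Lemma gpath_char_inj : injective (@gpath_char G).
Proof.
move=> p q pq.
have {}pq a : initial a p = initial a q by rewrite -!gpath_char_pidem pq.
case: p q pq => [a|w] [b|w'] pq.
- congr inl; have ab := pq a; rewrite initialxx in ab.
  have ba := pq b; rewrite initialxx in ba.
  apply: initial_anti; first by rewrite -ab.
  by move: ba; rewrite initialE => /andP[_ /size_prefix].
(* An infinite path has an initial segment one edge longer than [a], which cannot be initial in
   [a]. *)
- have [c cw cE] := finpath_prefix (inr w') (flen a).+1.
  move: cw; rewrite -pq initialE => /andP[_ /size_prefix].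
  by rewrite cE /= size_map size_iota ltnn.
- have [c cw cE] := finpath_prefix (inr w) (flen b).+1.
  move: cw; rewrite pq initialE => /andP[_ /size_prefix].
  by rewrite cE /= size_map size_iota ltnn.
congr inr; apply: infpath_ext => n; have [c cw cE] := finpath_prefix (inr w) n.+1.
move: (cw); rewrite pq => /andP[_ /eqP cE'].
have cn : flen c = n.+1 by rewrite /flen cE size_mkseq.
have : mkseq w n.+1 = mkseq w' n.+1 by rewrite -[LHS]cE cE' cn.
by move=> /(congr1 (nth (w 0%N) ^~ n)); rewrite !nth_mkseq.
Qed.

Lemma unit_char_inj : injective (@unit_char G).
Proof.
move=> [p|] [q|] //=; first by move=> /gpath_char_inj ->.
  by move=> /(congr1 (fun x : semichar S => x zidem)).
by move=> /(congr1 (fun x : semichar S => x zidem)).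
Qed.

Lemma unbounded_semichar x : ~~ x zidem ->
  (forall n, exists a, x (pidem a) /\ flen a = n) ->
  exists w : infpath G, x = gpath_char (inr w).
Proof.
move=> x0 xlen.
have [A /all_and2 [xA lenA]] := choice xlen.
(* The default edge for [nth] comes from the path [A 1], which has length 1. *)
have [e0 _] : exists e0 : edge G, True.
  by have := lenA 1%N; rewrite /flen; case: (fedges _) => // e0; exists e0.
pose w n := nth e0 (fedges (A n.+1)) n.
(* By comparability [c] extends [A i.+1], so both have the same edge at position [i]. *)
have wE c i : x (pidem c) -> (i < flen c)%N -> nth e0 (fedges c) i = w i.
  move=> xc ic; have := semichar_comparable x0 (xA i.+1) xc.
  rewrite lenA => /(_ ic) /andP[_ /eqP]; rewrite lenA /= => wA.
  by rewrite /w wA nth_take.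
have wP n : etgt (w n) = esrc (w n.+1).
  rewrite -!(wE (A n.+2)) ?lenA //.
  by apply: (walk_nth _ (valP (A n.+2))); rewrite -/(flen _) lenA.
pose W := InfPath wP.
(* The source of [W] is that of its first edge, so the comparison is made for non-empty [c]. *)
have xW c : x (pidem c) -> (0 < flen c)%N -> initial c (inr W).
  move=> xc c0; apply/andP; split.
    move: (valP c) (wE _ _ xc c0) (c0); rewrite /flen -/(fsrc c) -/(fedges c) /=.
    by case: (fedges c) => //= e l /andP[/eqP <- _] <-.
  apply/eqP; apply: (@eq_from_nth _ e0) => [|i ic]; first exact/esym/(size_mkseq w).
  rewrite [gtake _ _]/(mkseq w _).
  by rewrite nth_mkseq // wE.
exists W; apply: semichar_gis_ext => [|c]; first exact/negbTE.
(* A path one edge longer than [c] is non-empty, so [xW] applies to it even when [c] has length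
   0. *)
have xd := xA (flen c).+1; have dW := xW _ xd; rewrite lenA in dW.
have cd : (flen c <= flen (A (flen c).+1))%N by rewrite lenA.
apply/idP/idP => [xc|].
  exact: initial_trans (semichar_comparable x0 xc xd cd) (dW _).
move=> cW; exact: semichar_initial (initial_comparable cW (dW _) cd) xd.
Qed.

(** Away from z, if paths of every length take the value 1, [x] comes from an infinite path.
    Otherwise a missing length bounds all others, because truncations keep the value 1, and [x]
    comes from the longest such path. *)
Lemma unit_char_surj x : exists o, unit_char o = x.
Proof.
have [/semichar_zidem ->|x0] := boolP (x zidem); first by exists None.
have [xlen|] := pselect (forall n, exists a, x (pidem a) /\ flen a = n).
  by have [w ->] := unbounded_semichar x0 xlen; exists (Some (inr w)).
move=> /existsNP[n nlen].
have xn a : x (pidem a) -> (flen a <= n)%N.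
  move=> xa; rewrite leqNgt; apply/negP => na; apply: nlen.
  have [c ca cE] := finpath_prefix (inl a) n; exists c; split.
    exact: semichar_initial ca xa.
  by rewrite /flen cE /= size_takel // ltnW.
pose P k := `[< exists a, x (pidem a) /\ flen a = k >].
have exP : exists k, P k.
  have [e] := semichar_neq0 x; have [->|[a ->]] := idem_gisP e; first by rewrite (negbTE x0).
  by move=> xa; exists (flen a); apply/asboolP; exists a.
have bP k : P k -> (k <= n)%N by move=> /asboolP[a [xa <-]]; exact: xn.
case: (ex_maxnP exP bP) => k /asboolP[a [xa ak]] kmax.
exists (Some (inl a)); apply/esym/semichar_gis_ext => [|c]; first exact/negbTE.
apply/idP/idP => [xc|ca]; last exact: semichar_initial ca xa.
apply: (semichar_comparable x0 xc xa); rewrite ak.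
by apply/kmax/asboolP; exists c.
Qed.

End GraphSemigroup.

(** * Germs as triples *)

Section GermTriples.
Variable G : digraph.
Local Notation S := (gis G).
Local Notation H := (univ_groupoid S).
Implicit Types (a b : finpath G) (p q r : gpath G) (s t : S) (x : semichar S) (g h : H).
Local Open Scope group_scope.

Definition path_of x : option (gpath G) := sval (cid (unit_char_surj x)).

Lemma path_ofK x : unit_char (path_of x) = x.
Proof. by rewrite /path_of; case: cid. Qed.

Lemma unit_charK o : path_of (unit_char o) = o.
Proof. by apply: unit_char_inj; rewrite path_ofK. Qed.

Lemma semichar_path x : ~~ x (zidem G) -> exists p, x = gpath_char p.
Proof.
by case: (unit_char_surj x) => [[p|]] <-; [exists p|].
Qed.

(** The degree is read off the chosen representative; by [gis_deg_germ] it does not depend on that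
    choice away from z. *)
Definition germ_triple g : option (triple G) :=
  if (path_of (grange g), path_of (gsource g)) is (Some p, Some q)
  then Some (p, gis_deg (val (repr g : pregerm S)).2, q) else None.

Lemma gsource_zidem g : gsource g (zidem G) = grange g (zidem G).
Proof.
by have [x [s [xs ->]]] := germ_surj g; rewrite gsource_germ grange_germ act_zidem.
Qed.

Lemma germ_triple_zidem g : grange g (zidem G) -> germ_triple g = None.
Proof.
by rewrite /germ_triple => /semichar_zidem ->; rewrite -[one_char G]/(unit_char None) unit_charK.
Qed.

Lemma germ_triple_germ x s (xs : in_dom x s) p q :
  x = gpath_char p -> act xs = gpath_char q ->
  germ_triple (germ xs) = Some (p, gis_deg s, q).
Proof.
move=> xp xq; have xP : path_of x = Some p by rewrite xp (unit_charK (Some p)).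
rewrite /germ_triple grange_germ gsource_germ xP xq (unit_charK (Some q)).
have [t [xt [-> [e xe est]]]] := repr_germ xs.
by rewrite /= (gis_deg_germ _ xs xe est) // xp.
Qed.

Lemma germ_pathP g : ~~ grange g (zidem G) ->
  exists x s (xs : in_dom x s) p q,
    [/\ g = germ xs, x = gpath_char p, act xs = gpath_char q &
        germ_triple g = Some (p, gis_deg s, q)].
Proof.
have [x [s [xs ->]]] := germ_surj g; rewrite grange_germ => x0.
have [p xp] := semichar_path x0.
have [q xq] : exists q, act xs = gpath_char q.
  by apply: semichar_path; rewrite act_zidem.
by exists x, s, xs, p, q; split=> //; exact: germ_triple_germ.
Qed.

Lemma germ_gcatP p a b (ab : frng a = frng b) (xs : in_dom (gpath_char p) (gis_pair ab)) :
  exists r (ar : frng a = gsrc r) (br : frng b = gsrc r),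
    p = gcat ar /\ act xs = gpath_char (gcat br).
Proof.
have : initial a p by rewrite -gpath_char_pidem -(ran_pair ab).
move=> /initial_gcatP[r [ar pE]]; subst p.
have br : frng b = gsrc r by rewrite -ab.
by exists r, ar, br; split=> //; exact: act_gcat.
Qed.

Lemma in_dom_gcat a b (ab : frng a = frng b) p (ap : frng a = gsrc p) :
  in_dom (gpath_char (gcat ap)) (gis_pair ab).
Proof. by rewrite /in_dom ran_pair gpath_char_pidem initial_gcat. Qed.

Lemma germ_triple_gcat a b (ab : frng a = frng b) p (ap : frng a = gsrc p)
    (bp : frng b = gsrc p) : germ_triple (germ (in_dom_gcat ab ap)) =
  Some (gcat ap, ((flen a)%:Z - (flen b)%:Z)%R, gcat bp).
Proof. by rewrite (germ_triple_germ (erefl _) (act_gcat bp _)). Qed.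

Lemma trange_germ_triple g : unit_char (trange (germ_triple g)) = grange g.
Proof.
have [g0|/germ_pathP[x [s [xs [p [q [gE xp xq ->]]]]]]] := boolP (grange g (zidem G)).
  by rewrite germ_triple_zidem //; apply/esym/semichar_zidem.
by rewrite gE grange_germ.
Qed.

Lemma tsource_germ_triple g : unit_char (tsource (germ_triple g)) = gsource g.
Proof.
have [g0|/germ_pathP[x [s [xs [p [q [gE xp xq ->]]]]]]] := boolP (grange g (zidem G)).
  by rewrite germ_triple_zidem //; apply/esym/semichar_zidem; rewrite gsource_zidem.
by rewrite gE gsource_germ.
Qed.

Lemma germ_triple_eq0 g : (germ_triple g = None) <-> grange g (zidem G).
Proof.
by split=> [gN|/germ_triple_zidem //]; rewrite -trange_germ_triple gN.
Qed.

Lemma germ_triple_inj : injective germ_triple.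
Proof.
move=> g h gh.
have : grange g = grange h by rewrite -!trange_germ_triple gh.
have : gsource g = gsource h by rewrite -!tsource_germ_triple gh.
have [g0|g0] := boolP (grange g (zidem G)).
  move: g0; have [x [s [xs ->]]] := germ_surj g; have [y [t [yt ->]]] := germ_surj h.
  rewrite !grange_germ => x0 _ ?; subst y; apply/germP; split=> //.
  (* Multiplication by zero identifies all elements of [S], so z carries a single germ. *)
  by exists (zidem G).
have [x [s [xs [p [q [gE xp xq gT]]]]]] := germ_pathP g0.
move: gh; rewrite gT; have [y [t [yt ->]]] := germ_surj h.
rewrite gE !grange_germ !gsource_germ => + act_eq ?; subst y.
rewrite (germ_triple_germ xp (q := q)) -?act_eq // => -[st].
by apply: germ_eq => //; rewrite xp.
Qed.

Lemma Psi_zero : Psi (gis_zero G) = germ_triple @^-1` [set None].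
Proof.
apply/seteqP; split=> [_ [x [xs ->]] /=|g /germ_triple_eq0].
  by apply/germ_triple_eq0; rewrite grange_germ.
have [x [s [xs ->]]] := germ_surj g; rewrite grange_germ => x0.
by exists x, x0; apply/germP; split=> //; exists (zidem G).
Qed.

Lemma Psi_pair a b (ab : frng a = frng b) : Psi (gis_pair ab) =
  germ_triple @^-1` ([set None] `|` [set Some t | t in triple_set a b]).
Proof.
apply/seteqP; split=> [_ [x [xs ->]]|g [/germ_triple_eq0|]] /=.
- have [x0|x0] := boolP (x (zidem G)).
    by left; apply/germ_triple_eq0; rewrite grange_germ.
  right; have [p xp] := semichar_path x0; subst x.
  have [r [ar [br [pE actE]]]] := germ_gcatP xs.
  exists (gcat ar, ((flen a)%:Z - (flen b)%:Z)%R, gcat br); first by exists r, ar, br.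
  by rewrite (germ_triple_germ (erefl (gpath_char p)) actE) pE.
(* The constant semicharacter lies in every domain, and its only germ belongs to every [Psi s]. *)
- have [x [s [xs ->]]] := germ_surj g; rewrite grange_germ => x0.
  have xab : in_dom x (gis_pair ab) by rewrite (semichar_zidem x0).
  by exists x, xab; apply/germP; split=> //; exists (zidem G).
- move=> [_ [p [ap [bp ->]]]]; rewrite -(germ_triple_gcat ab) => /germ_triple_inj <-.
  by exists (gpath_char (gcat ap)), (in_dom_gcat ab ap).
Qed.

Lemma germ_triple_bij : set_bij [set: H]
  ([set None] `|` [set Some t | t in triples G]) germ_triple.
Proof.
split=> [g _|g h _ _|_ [->|[_ [a [b [p [ap [bp ->]]]]] <-]]].
- have [g0|g0] := boolP (grange g (zidem G)); first by left; exact: germ_triple_zidem.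
  right; have [x [s [xs [_ [_ [gE _ _ _]]]]]] := germ_pathP g0.
  have [s0|[a [b [ab sE]]]] := gisP s.
    by move: g0; rewrite gE grange_germ => x0; case: (in_dom_neq0 x0 xs).
  have : Psi (gis_pair ab) g by rewrite -sE; exists x, xs.
  rewrite Psi_pair => -[/germ_triple_eq0|[t abt <-]]; first by rewrite (negbTE g0).
  by exists t => //; exists a, b.
- exact: germ_triple_inj.
- have z : in_dom (one_char G) (gis_zero G) by [].
  by exists (germ z) => //; apply/germ_triple_eq0; rewrite grange_germ.
(* That [a] and [b] have the same end follows from both ending at the source of [p]. *)
exists (germ (in_dom_gcat (etrans ap (esym bp)) ap)) => //.
exact: germ_triple_gcat.
Qed.

Lemma tcomposableE (t u : option (triple G)) :
  tcomposable t u <-> tsource t = trange u.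
Proof.
case: t u => [[[p m] q]|] [[[p' m'] q']|] //=.
by split=> [->|[->]].
Qed.

Lemma composableE g h : composable g h <-> tcomposable (germ_triple g) (germ_triple h).
Proof.
rewrite tcomposableE /composable -tsource_germ_triple -trange_germ_triple.
by split=> [/unit_char_inj|->].
Qed.

Lemma germ_triple_mul g h : composable g h ->
  germ_triple (gmul g h) = tmul (germ_triple g) (germ_triple h).
Proof.
move=> gh; have [g0|g0] := boolP (grange g (zidem G)).
  by rewrite (germ_triple_zidem g0) germ_triple_zidem ?grange_gmul.
move: gh g0 => /composable_germP[x [s [t [xs [yt [-> ->]]]]]].
rewrite grange_germ (gmul_germ _ (mul_dom yt)) => x0.
have y0 : ~~ act xs (zidem G) by rewrite act_zidem.
have z0 : ~~ act yt (zidem G) by rewrite act_zidem.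
have [[p xp] [q yq] [r zr]] := And3 (semichar_path x0) (semichar_path y0) (semichar_path z0).
rewrite (germ_triple_germ xp yq) (germ_triple_germ yq zr).
rewrite (germ_triple_germ (q := r) xp) ?actM // gis_degM //.
exact: (in_dom_neq0 x0 (mul_dom yt)).
Qed.

Lemma germ_triple_inv g : germ_triple (ginv g) = tinv (germ_triple g).
Proof.
have [g0|/germ_pathP[x [s [xs [p [q [gE xp xq gT]]]]]]] := boolP (grange g (zidem G)).
  by rewrite !germ_triple_zidem // grange_ginv gsource_zidem.
rewrite gT gE ginv_germ (germ_triple_germ (q := p) xq) ?act_star //.
by rewrite gis_deg_star.
Qed.

(** * Separation of points of H *)

Lemma nbhs_degree g : nbhs g [set h |
  omap (fun u : triple G => u.1.2) (germ_triple h) = omap (fun u : triple G => u.1.2) (germ_triple g)].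
Proof.
have [x [s [xs ->]]] := germ_surj g; apply/nbhs_germ.
(* Nearby germs are germs of the same [s] at base points with the same value at z, so they are all z
   or all of degree [gis_deg s]. *)
apply: filterS (char_nbhs_eval x (zidem G)) => y /= yx ys.
have [x0|x0] := boolP (x (zidem G)); first by rewrite !germ_triple_zidem ?grange_germ ?yx.
have key z (zs : in_dom z s) : ~~ z (zidem G) ->
    omap (fun u : triple G => u.1.2) (germ_triple (germ zs)) = Some (gis_deg s).
  move=> z0; have w0 : ~~ act zs (zidem G) by rewrite act_zidem.
  have [p zp] := semichar_path z0; have [q wq] := semichar_path w0.
  by rewrite (germ_triple_germ zp wq).
by rewrite !key ?yx.
Qed.

Lemma hausdorff_univ_groupoid : hausdorff_space H.
Proof.
move=> g h gh.
(* A locally constant function takes equal values at points without disjoint neighbourhoods. *)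
have sep (T : Type) (f : H -> T) : (forall k, nbhs k [set l | f l = f k]) -> f g = f h.
  by move=> fk; have [k [<- <-]] := gh _ _ (fk g) (fk h).
have rgh : grange g = grange h.
  apply: semichar_ext => e; apply: (sep _ (fun k => grange k e)) => k; exact: nbhs_grange.
have sgh : gsource g = gsource h.
  apply: semichar_ext => e; apply: (sep _ (fun k => gsource k e)) => k; exact: nbhs_gsource.
have := sep _ _ nbhs_degree.
have trgh : trange (germ_triple g) = trange (germ_triple h).
  by apply: unit_char_inj; rewrite !trange_germ_triple.
have tsgh : tsource (germ_triple g) = tsource (germ_triple h).
  by apply: unit_char_inj; rewrite !tsource_germ_triple.
move=> dgh; apply: germ_triple_inj; move: trgh tsgh dgh.
case: (germ_triple g) (germ_triple h) => [[[p m] q]|] [[[p' m'] q']|] //=.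
by move=> [->] [->] [->].
Qed.

End GermTriples.

Theorem theorem1 (G : digraph) (hG : no_sinks G) :
  exists Phi : univ_groupoid (gis G) -> option (triple G),
  [/\ set_bij [set: univ_groupoid (gis G)]
        ([set None] `|` [set Some t | t in triples G]) Phi,
      (forall g, grange g = unit_char (trange (Phi g)) /\
                 gsource g = unit_char (tsource (Phi g))),
      (forall g h, (composable g h <-> tcomposable (Phi g) (Phi h)) /\
                   (composable g h -> Phi (gmul g h) = tmul (Phi g) (Phi h))) /\
      (forall g, Phi (ginv g) = tinv (Phi g)),
      [/\ (forall s : gis G, in_ample (Psi s)),
          Psi (gis_zero G) = Phi @^-1` [set None] &
          forall (a b : finpath G) (ab : frng a = frng b),
            [/\ Psi (gis_pair ab) =
                  Phi @^-1` ([set None] `|` [set Some t | t in triple_set a b]),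
                compact (Phi @^-1` [set Some t | t in triple_set a b]) &
                open (Phi @^-1` [set Some t | t in triple_set a b])]] &
      locally_compact_groupoid (@composable (gis G)) (@gmul (gis G)) (@ginv (gis G)) /\
      hausdorff_space (univ_groupoid (gis G))].
Proof.
have hH := @hausdorff_univ_groupoid G.
exists (@germ_triple G); split.
- exact: germ_triple_bij.
- by move=> g; rewrite trange_germ_triple tsource_germ_triple.
- split; last exact: germ_triple_inv.
  by move=> g h; split; [exact: composableE|exact: germ_triple_mul].
- split; [by move=> s; exact: Psi_ample|exact: Psi_zero|move=> a b ab].
  (* A_{a,b} is [Psi (gis_pair ab)] without the point z. That point is [Psi] of the zero, open and
     compact, hence clopen as H is Hausdorff, so removing it keeps the set compact and open. *)
  have AE : @germ_triple G @^-1` [set Some t | t in triple_set a b] =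
      Psi (gis_pair ab) `&` ~` Psi (gis_zero G).
    rewrite Psi_pair Psi_zero; apply/seteqP; split=> g /=.
      by move=> abg; split; [right|case: abg => t _ <-].
    by move=> [[|]].
  rewrite AE; split; first exact: Psi_pair.
    by apply: compact_closedI; [exact: compact_Psi|apply/open_closedC/open_Psi].
  apply: openI; first exact: open_Psi.
  by apply/closed_openC/(compact_closed hH); exact: compact_Psi.
- by split => //; exact: univ_groupoid_locally_compact.
Qed.
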